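(* Let $\{X_u:u\in\Lambda^*\setminus\{\emptyset\}\}$ be i.i.d. copies of a nonnegative random variable $X$ with $\mathbb E(X)=1$, and let $Q$ be the associated Mandelbrot multiplicative cascade. If $\nu$ is a Borel probability measure on $\Sigma$ that is invariant and ergodic under the left shift $\sigma$, then $\nu$ is either $Q$-regular or $Q$-singular.
   Context: Let $b\ge2$ be an integer, $\Lambda=\{0,\dots,b-1\}$, $\Lambda^*=\bigcup_{n\ge0}\Lambda^n$ the finite words, and $\Sigma=\Lambda^{\mathbb N}$ the space of sequences $x=x_1x_2\cdots$ with the product topology and Borel $\sigma$-field; $\sigma$ is the left shift on $\Sigma$. Write $x|_n=x_1\cdots x_n$. For $n\ge1$ put $Q_n(\omega,x)=\prod_{k=1}^nX_{x|_k}(\omega)$. For a finite Borel measure $\nu$ on $\Sigma$, the measures $Q_n(\omega,\cdot)\,\nu$ almost surely converge weakly to a random measure $Q\cdot\nu$. The measure $\nu$ is called $Q$-regular if $\mathbb E\|Q\cdot\nu\|=\|\nu\|$ (where $\|\cdot\|$ is total mass), and $Q$-singular if $Q\cdot\nu=0$ almost surely. *)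

(* Defs.v *)
From HB Require Import structures.
From mathcomp Require Import all_boot all_order all_algebra.
From mathcomp Require Import all_classical all_reals all_analysis.

Set Implicit Arguments.
Unset Strict Implicit.
Unset Printing Implicit Defensive.

Import Order.TTheory GRing.Theory Num.Theory.
Import numFieldNormedType.Exports.

Local Open Scope classical_set_scope.
Local Open Scope ring_scope.

(* ['I_b], made a pointed type by [1 < b], as measurable types are pointed *)
Definition letter (b : nat) (hb : (1 < b)%N) : Type := 'I_b.

HB.instance Definition _ b hb := Finite.copy (@letter b hb) 'I_b.
HB.instance Definition _ b hb :=
  isPointed.Build (@letter b hb) (Ordinal (ltnW hb)).

(* The value [x k] is the letter x_{k+1}. *)
Definition Sigma (b : nat) (hb : (1 < b)%N) : Type :=
  prod_topology (fun _ : nat => discrete_topology (letter hb)).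

HB.instance Definition _ b hb := Pointed.on (@Sigma b hb).
HB.instance Definition _ b hb := Topological.on (@Sigma b hb).
HB.instance Definition _ b hb := Measurable.copy (@Sigma b hb)
  (g_sigma_algebraType (@open (@Sigma b hb))).

Definition left_shift (b : nat) (hb : (1 < b)%N) (x : Sigma hb) : Sigma hb :=
  fun k => x k.+1.

(* x|_n *)
Definition initial_word (b : nat) (hb : (1 < b)%N) (x : Sigma hb) (n : nat) :
  seq (letter hb) := mkseq x n.

Definition shift_invariant (b : nat) (hb : (1 < b)%N) (R : realType)
    (nu : probability (Sigma hb) R) : Prop :=
  forall A, measurable A -> nu (@left_shift b hb @^-1` A) = nu A.

Definition shift_ergodic (b : nat) (hb : (1 < b)%N) (R : realType)
    (nu : probability (Sigma hb) R) : Prop :=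
  forall A, measurable A -> @left_shift b hb @^-1` A = A ->
    nu A = 0%E \/ nu A = 1%E.

(* Mutual independence of the subfamily of [X] indexed by [D] *)
Definition mutually_independent (d : measure_display) (T : measurableType d)
    (R : realType) (P : probability T R) (I : eqType) (D : set I)
    (X : I -> {RV P >-> R}) : Prop :=
  forall (s : seq I) (B : I -> set R), uniq s -> [set` s] `<=` D ->
    (forall i, measurable (B i)) ->
    P (\big[setI/setT]_(i <- s) (X i @^-1` B i)) =
    (\prod_(i <- s) P (X i @^-1` B i))%E.

Definition same_distribution (d d' : measure_display) (T : measurableType d)
    (T' : measurableType d') (R : realType) (P : probability T R)
    (P' : probability T' R) (X : {RV P >-> R}) (Y : {RV P' >-> R}) : Prop :=
  forall B : set R, measurable B -> distribution P X B = distribution P' Y B.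

Definition nonempty_words (b : nat) (hb : (1 < b)%N) :
  set (seq (letter hb)) := [set u | u != [::]].
Arguments nonempty_words {b} hb.

(* Weak convergence.  The approximating measures are plain set functions, so
   that the definition applies to [weighted_measure] for every outcome, also on
   the null event where some weight is negative. *)
Definition weak_cvg (R : realType) (b : nat) (hb : (1 < b)%N)
    (mu_ : nat -> set (Sigma hb) -> \bar R)
    (mu : {finite_measure set (Sigma hb) -> \bar R}) : Prop :=
  forall f : Sigma hb -> R, continuous f -> bounded_fun f ->
    (\int[mu_ n]_x (f x)%:E)%E @[n --> \oo] --> (\int[mu]_x (f x)%:E)%E.

Section cascade.
Context (b : nat) (hb : (1 < b)%N) (d : measure_display)
  (Omega : measurableType d) (R : realType) (P : probability Omega R).
Variable X : seq (letter hb) -> {RV P >-> R}.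

Definition cascade_weight (n : nat) (w : Omega) (x : Sigma hb) : R :=
  \prod_(1 <= k < n.+1) X (initial_word x k) w.

Variable nu : {finite_measure set (Sigma hb) -> \bar R}.

(* The measure Q_n(w, .) nu *)
Definition weighted_measure (w : Omega) (n : nat) (A : set (Sigma hb)) : \bar R :=
  (\int[nu]_(x in A) (cascade_weight n w x)%:E)%E.

Definition has_cascade_limit (w : Omega) : Prop :=
  exists mu : {finite_measure set (Sigma hb) -> \bar R},
    weak_cvg (weighted_measure w) mu.

(* The random measure Q.nu: the weak limit of Q_n(w, .) nu, which exists almost
   surely when the weights are i.i.d., nonnegative and of mean 1; the value
   [mzero] is a dummy for the null event where there is no limit.  The limit is
   unique on Borel sets. *)
Definition cascade_measure (w : Omega) :
    {finite_measure set (Sigma hb) -> \bar R} :=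
  match pselect (has_cascade_limit w) with
  | left ex_mu => projT1 (cid ex_mu)
  | right _ => mzero
  end.

Definition cascade_regular : Prop :=
  (\int[P]_w cascade_measure w setT = nu setT)%E.

Definition cascade_singular : Prop :=
  {ae P, forall w, forall A, measurable A -> cascade_measure w A = 0%E}.

End cascade.

(* Main.v *)
(* Let [I m] be the expected mass of [Q.m], for [m] a nonnegative additive
   function on words.  The masses [Q_n m] form a nonnegative martingale, so they
   converge almost surely and [I] is additive in [m]; by self-similarity of the
   cascade, [I m] is the sum of the [I m_i] over the letters [i], where [m_i] is
   the part of [m] on the cylinder of [i], transported by the shift.  Hence, for
   [nu] invariant, the measure E(Q.nu), whose value on the cylinder of [u] is
   [I nu_u], is invariant and bounded by [nu]; by ergodicity it is [c nu] with
   [c = I nu].  Conditioning the limit mass [Z] on the first [n] levels of the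
   weights then gives c Q_n(nu), that is, E(h Z) = c E(h Q_n(nu)) for every
   [h >= 0] depending on these levels only.  The choice [h = 1 / (1 + Q_n(nu))]
   and the limit in [n] yield E(Z / (1 + Z)) = c E(Z / (1 + Z)): either [c = 1]
   or [Z = 0] almost surely. *)

Require Import Defs.
From HB Require Import structures.
From mathcomp Require Import all_boot all_order all_algebra.
From mathcomp Require Import all_classical all_reals all_analysis.
From mathcomp Require Import measurable_realfun lra.

Set Implicit Arguments.
Unset Strict Implicit.
Unset Printing Implicit Defensive.

Import Order.TTheory GRing.Theory Num.Theory.
Import numFieldNormedType.Exports.

Local Open Scope classical_set_scope.
Local Open Scope ring_scope.

(** * Convergence of nonnegative martingales *)

(** Nothing makes the masses [Q_n nu] uniformly integrable, and Fatou's lemma only gives [c <= 1].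
    The test function 1 / (1 + Q_n) keeps both sides under control: against [Z] the product is
    dominated by [Z], against [Q_n] by 1, and both products tend to Z / (1 + Z). The measure E(Q.nu)
    is not formed from the random measure. It is rebuilt from its values on words, as an image of
    Lebesgue measure, and so is its difference with [nu], which carries the bound by [nu] from
    cylinders to Borel sets. Self-similarity is a statement about laws, so the argument runs on the
    space of all weight families, under the law of [X], where passing to a subtree is a reindexing.
    There the weights enter through absolute values and the limit is a lower limit: every functional
    is nonnegative and measurable everywhere, and agrees almost surely with the one of the cascade.
    The random measure itself returns only at the end, where a weak limit of total mass [Z] is
    constructed for almost every outcome. *)

Section upcrossings.
Variable R : realType.
Variables (a c : R) (y : nat -> R).

(** The buy-low, sell-high strategy of Doob: a unit is bought when [y] is at most [a] and sold when
    [y] reaches [c]. The position after time [n] depends on the values up to [n] only. *)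
Fixpoint holding n : bool :=
  if n is k.+1 then (if holding k then y k.+1 < c else y k.+1 <= a)
  else y 0%N <= a.

Definition upcrossings n : nat := (\sum_(k < n) (holding k && (c <= y k.+1)%R))%N.

(* Holding one unit from each time [y <= a] to the next time [y >= c] earns at
   least [c - a] per upcrossing and loses at most [a] in the last one. *)
Lemma upcrossings_gain n : 0 <= a -> a < c -> (forall k, 0 <= y k) ->
  (c - a) * (upcrossings n)%:R + \sum_(k < n) (holding k)%:R * y k <=
  \sum_(k < n) (holding k)%:R * y k.+1 + a.
Proof.
move=> a0 ac y0.
(* The invariant also values the open position: a unit still held was bought at a price at most [a],
   so it has gained at least [y n - a]. *)
suff: (c - a) * (upcrossings n)%:R + \sum_(k < n) (holding k)%:R * y k
    + (holding n)%:R * (y n - a) <= \sum_(k < n) (holding k)%:R * y k.+1.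
  by have := y0 n; case: (holding n) => /=; lra.
elim: n => [|n IH].
  by rewrite /upcrossings !big_ord0 /=; case: (leP (y 0%N) a) => ? /=; lra.
move: IH; rewrite /upcrossings !big_ord_recr /= natrD.
set U := (X in X%:R).
pose A := \sum_(k < n) (holding k)%:R * y k; rewrite -/A.
pose B := \sum_(k < n) (holding k)%:R * y k.+1; rewrite -/B.
case: (holding n) => /=.
  by case: (leP c (y n.+1)) => cy /= IH; lra.
by case: (leP (y n.+1) a) => ya /= IH; lra.
Qed.

Lemma holding_frequently n : (forall n, exists2 k, (n < k)%N & y k <= a) ->
  exists2 k, (n <= k)%N & holding k.
Proof.
move=> /(_ n)[[//|k] nk yk].
case h : (holding k); first by exists k.
by exists k.+1; [exact: ltnW | rewrite /= h].
Qed.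

Lemma holding_upcrossing n k : holding n -> (n < k)%N -> c <= y k ->
  exists2 j, (n <= j)%N & holding j && (c <= y j.+1).
Proof.
move=> hn nk cy; have [d kE] : exists d, k = (n + d)%N.
  by exists (k - n)%N; rewrite subnKC// ltnW.
move: kE hn nk cy => ->{k}.
elim: d n => [n|d IH n hn nk cy]; first by rewrite addn0 ltnn.
have [cy1|cy1] := leP c (y n.+1); first by exists n; rewrite ?hn.
have [|||j nj hj] := IH n.+1.
- by rewrite /= hn.
- case: d {IH nk} cy => [|d _]; first by rewrite addn1 leNgt cy1.
  by rewrite addnS ltnS leq_addr.
- by rewrite addSnnS.
by exists j => //; exact: ltnW.
Qed.

Lemma upcrossings_unbounded N : (forall n, exists2 k, (n < k)%N & y k <= a) ->
  (forall n, exists2 k, (n < k)%N & c <= y k) -> exists n, (N <= upcrossings n)%N.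
Proof.
move=> ya yc; elim: N => [|N [n Nn]]; first by exists 0%N.
have [k nk hk] := holding_frequently n ya.
have [l kl cl] := yc k.
have [j kj hj] := holding_upcrossing hk kl cl.
exists j.+1; rewrite /upcrossings big_ord_recr /= hj addn1 ltnS.
rewrite (leq_trans Nn)// -(subnKC (leq_trans nk kj)) /upcrossings big_split_ord /=.
exact: leq_addr.
Qed.

End upcrossings.

Section upcrossing_convergence.
Variable R : realType.
Implicit Types y : nat -> R.
Local Open Scope ereal_scope.

Lemma limn_einf_frequently y (a : R) : limn_einf (EFin \o y) < a%:E ->
  forall n, exists2 k, (n < k)%N & (y k <= a)%R.
Proof.
move=> ya n; apply: contrapT => h; move: ya; apply/negP; rewrite -leNgt.
rewrite limn_einf_lim; have /cvg_lim -> // := @cvg_einfs_sup R (EFin \o y).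
apply: le_trans (ereal_sup_ubound _); last by exists n.+1.
apply/ereal_infP => _ [k /= nk <-]; rewrite lee_fin leNgt; apply/negP => ka.
by apply: h; exists k => //; exact: ltW.
Qed.

Lemma limn_esup_frequently y (c : R) : c%:E < limn_esup (EFin \o y) ->
  forall n, exists2 k, (n < k)%N & (c <= y k)%R.
Proof.
move=> yc n.
have [|k nk yk] := @limn_einf_frequently (fun n => - y n)%R (- c)%R _ n.
  rewrite (_ : EFin \o _ = -%E \o (EFin \o y))//.
  by rewrite limn_einfN EFinN lteN2.
by exists k => //; rewrite -lerN2.
Qed.

(** A gap between the lower and the upper limit contains two rationals, and [y] passes below the one
    and above the other infinitely often. Rational levels keep the hypothesis a countable family,
    which can hold simultaneously almost surely. *)
Lemma bounded_upcrossings_cvg y : (forall n, 0 <= y n)%R ->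
  limn_einf (EFin \o y) < +oo ->
  (forall p q : rat, (0 < (ratr p : R) < ratr q)%R ->
    exists K, forall n, (upcrossings (ratr p) (ratr q) y n <= K)%N) ->
  cvgn y.
Proof.
move=> y0 yoo upy.
have einf0 : 0 <= limn_einf (EFin \o y).
  rewrite limn_einf_lim; have /cvg_lim -> // := @cvg_einfs_sup R (EFin \o y).
  apply: le_trans (ereal_sup_ubound _); last by exists 0%N.
  by apply/ereal_infP => _ [k /= nk <-]; rewrite lee_fin.
have einf_fin : limn_einf (EFin \o y) \is a fin_num by rewrite ge0_fin_numE.
have : ~ (limn_einf (EFin \o y) < limn_esup (EFin \o y)).
  move=> lt.
  have [s rs sy] : exists2 s : R, (fine (limn_einf (EFin \o y)) < s)%R &
      s%:E < limn_esup (EFin \o y).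
    move: lt; rewrite -{1}(fineK einf_fin).
    case: (limn_esup _) => [t| |//]; last first.
      by exists (fine (limn_einf (EFin \o y)) + 1)%R; rewrite ?ltrDl// ltry.
    rewrite lte_fin => lt; exists ((fine (limn_einf (EFin \o y)) + t) / 2)%R.
      by rewrite midf_lt.
    by rewrite lte_fin midf_lt.
  have [p] := rat_in_itvoo rs; rewrite in_itv/= => /andP[rp ps].
  have [q] := rat_in_itvoo ps; rewrite in_itv/= => /andP[pq qs].
  have [|K UK] := upy p q.
    by rewrite pq andbT (le_lt_trans _ rp)// fine_ge0.
  have [||n] := @upcrossings_unbounded R (ratr p) (ratr q) y K.+1.
  - by apply: limn_einf_frequently; rewrite -(fineK einf_fin) lte_fin.
  - by apply: limn_esup_frequently; rewrite (lt_trans _ sy)// lte_fin.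
  - by rewrite leqNgt ltnS UK.
move=> /negP; rewrite -leNgt => supinf.
have /eqP inf_sup : limn_einf (EFin \o y) == limn_esup (EFin \o y).
  by rewrite eq_le supinf limn_einf_sup.
have : EFin \o y @ \oo --> limn_einf (EFin \o y).
  apply: (@squeeze_cvge _ _ _ _ (einfs (EFin \o y)) _ (esups (EFin \o y))).
  - apply: nearW => n /=; apply/andP; split.
      by apply: ereal_inf_lbound; exists n => //=.
    by apply: ereal_sup_ubound; exists n => //=.
  - by rewrite limn_einf_lim; exact: is_cvg_einfs.
  - by rewrite inf_sup limn_esup_lim; exact: is_cvg_esups.
rewrite -(fineK einf_fin) => /fine_cvgP[_ cy].
by apply/cvg_ex; exists (fine (limn_einf (EFin \o y))).
Qed.

End upcrossing_convergence.

Section limn_einf_bounds.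
Context (R : realType).
Implicit Types u : nat -> \bar R.
Local Open Scope ereal_scope.

Lemma limn_einf_ge u C N : (forall k, (N <= k)%N -> C <= u k) -> C <= limn_einf u.
Proof.
move=> Cu; rewrite limn_einf_lim; have /cvg_lim -> // := @cvg_einfs_sup R u.
apply: le_trans (ereal_sup_ubound _); last by exists N.
by apply/ereal_infP => _ [k /= Nk <-]; exact: Cu.
Qed.

Lemma limn_einf_le u C : (forall n, u n <= C) -> limn_einf u <= C.
Proof.
move=> uC; rewrite limn_einf_lim; have /cvg_lim -> // := @cvg_einfs_sup R u.
apply/ereal_supP => _ [n _ <-]; apply: le_trans (uC n).
by apply: ereal_inf_lbound; exists n => /=.
Qed.

End limn_einf_bounds.

Lemma ae_forall_countable d (T : measurableType d) (R : realType)
    (mu : {measure set T -> \bar R}) (I : countType) (Q : I -> T -> Prop) :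
  (forall i, {ae mu, forall x, Q i x}) -> {ae mu, forall x, forall i, Q i x}.
Proof.
move=> aeQ; have : {ae mu, forall x (n : nat),
    if @unpickle I n is Some i then Q i x else True}.
  by apply/ae_foralln => n; case: unpickle => [i|]; [exact: aeQ|apply: aeW].
by apply: filterS => x Qx i; have := Qx (pickle i); rewrite pickleK.
Qed.

Section fatou_finite.
Context d (T : measurableType d) (R : realType) (mu : {measure set T -> \bar R}).
Local Open Scope ereal_scope.

Lemma measurable_limn_einf (f : nat -> T -> \bar R) :
  (forall n, measurable_fun setT (f n)) ->
  measurable_fun setT (fun x => limn_einf (f ^~ x)).
Proof.
move=> mf; rewrite (_ : (fun x => _) = fun x => - limn_esup (fun n => - f n x)).
  apply: measurableT_comp => //.
  apply: measurable_fun_limn_esup => n.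
  exact: measurableT_comp.
by apply/funext => x; rewrite /limn_einf.
Qed.

(** By Fatou's lemma the lower limit has integral at most [C]. *)
Lemma ae_limn_einf_lty (f : nat -> T -> R) (C : R) :
  (forall n, measurable_fun setT (f n)) -> (forall n x, 0 <= f n x)%R ->
  (forall n, \int[mu]_x (f n x)%:E <= C%:E) ->
  {ae mu, forall x, limn_einf (fun n => (f n x)%:E) < +oo}.
Proof.
move=> mf f0 fC.
have mEf n : measurable_fun setT (EFin \o f n) by exact/measurable_EFinP.
have l0 x : 0 <= limn_einf (fun n => (f n x)%:E).
  by apply: (@limn_einf_ge _ _ _ 0%N) => n _; rewrite lee_fin.
have : mu.-integrable setT (fun x => limn_einf (fun n => (f n x)%:E)).
  apply/integrableP; split; first exact: measurable_limn_einf.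
  under eq_integral do rewrite gee0_abs//.
  have := @fatou _ _ _ mu _ measurableT (fun n => EFin \o f n) mEf.
  move=> /(_ _)/le_lt_trans -> //.
    by move=> n x _ /=; rewrite lee_fin.
  apply: le_lt_trans (ltry C).
  exact: limn_einf_le.
move=> /(integrable_ae measurableT); apply: filterS => x /(_ I).
by rewrite ge0_fin_numE.
Qed.

End fatou_finite.

Section nonnegative_martingale.
Context d (T : measurableType d) (R : realType) (P : probability T R).
Variable Y : nat -> T -> R.
Hypotheses (mY : forall n, measurable_fun setT (Y n))
  (Y0 : forall n x, 0 <= Y n x) (Y0oo : (\int[P]_x (Y 0%N x)%:E < +oo)%E).
(** Conditional expectation is expressed by nonnegative test functions of [Y 0], ..., [Y n]; both
    sides may be infinite. *)
Hypothesis martingaleY : forall n (h : T -> R), measurable_fun setT h ->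
  (forall x, 0 <= h x) ->
  (forall x y, (forall k, (k <= n)%N -> Y k x = Y k y) -> h x = h y) ->
  (\int[P]_x (h x * Y n.+1 x)%:E = \int[P]_x (h x * Y n x)%:E)%E.

Lemma martingale_integral n : (\int[P]_x (Y n x)%:E = \int[P]_x (Y 0%N x)%:E)%E.
Proof.
elim: n => // n <-; have := @martingaleY n (cst 1).
under eq_integral do rewrite mul1r.
by move=> -> //; under eq_integral do rewrite mul1r.
Qed.

Lemma measurable_holding a c n :
  measurable_fun setT (fun x => holding a c (Y ^~ x) n).
Proof.
elim: n => [|n IH] /=; first exact: measurable_fun_ler.
apply: measurable_fun_ifT => //; first exact: measurable_fun_ltr.
exact: measurable_fun_ler.
Qed.

Lemma measurable_holdingR a c n :
  measurable_fun setT (fun x => (holding a c (Y ^~ x) n)%:R : R).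
Proof.
rewrite (_ : (fun x => _) = fun x => if holding a c (Y ^~ x) n then 1 else 0).
  by apply: measurable_fun_ifT => //; exact: measurable_holding.
by apply/funext => x; case: holding.
Qed.

Lemma eq_holding a c n x y : (forall k, (k <= n)%N -> Y k x = Y k y) ->
  holding a c (Y ^~ x) n = holding a c (Y ^~ y) n.
Proof.
elim: n => [|n IH] xy /=; first by rewrite xy.
by rewrite IH => [|k kn]; rewrite ?xy// leqW.
Qed.

Lemma measurable_upcrossings a c n :
  measurable_fun setT (fun x => (upcrossings a c (Y ^~ x) n)%:R : R).
Proof.
rewrite (_ : (fun x => _) = fun x => \sum_(k < n)
    if holding a c (Y ^~ x) k && (c <= Y k.+1 x) then 1 else 0).
  apply: measurable_sum => k; apply: measurable_fun_ifT => //.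
  by apply: measurable_and; [exact: measurable_holding|exact: measurable_fun_ler].
apply/funext => x; rewrite /upcrossings natr_sum; apply: eq_bigr => k _.
by case: ifPn.
Qed.

(** Doob's inequality: the strategy [holding] earns nothing on average, so the expectation of
    [upcrossings_gain] leaves only the possible last loss [a], whatever [n] is. *)
Lemma expected_upcrossings (a c : R) n : 0 <= a -> a < c ->
  (\int[P]_x ((c - a) * (upcrossings a c (Y ^~ x) n)%:R)%:E <= a%:E)%E.
Proof.
move=> a0 ac.
pose h k x : R := (holding a c (Y ^~ x) k)%:R.
have mh k : measurable_fun setT (h k) by exact: measurable_holdingR.
have h0 k x : 0 <= h k x by [].
have mhY k m : measurable_fun setT (fun x => h k x * Y m x).
  exact: measurable_funM.
have intS : (\int[P]_x (\sum_(k < n) h k x * Y k.+1 x)%:E =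
             \int[P]_x (\sum_(k < n) h k x * Y k x)%:E)%E.
  under eq_integral do rewrite -sumEFin.
  under [RHS]eq_integral do rewrite -sumEFin.
  rewrite !ge0_integral_sum//; first last.
  - by move=> k x _; rewrite lee_fin mulr_ge0.
  - by move=> k; exact/measurable_EFinP.
  - by move=> k x _; rewrite lee_fin mulr_ge0.
  - by move=> k; exact/measurable_EFinP.
  apply: eq_bigr => k _; apply: martingaleY => // x y xy.
  by rewrite /h (eq_holding _ _ xy).
(* Finiteness allows the common expected cost of the strategy to be cancelled from both sides. *)
have Sfin : (\int[P]_x (\sum_(k < n) h k x * Y k x)%:E)%E \is a fin_num.
  rewrite ge0_fin_numE; last first.
    apply: integral_ge0 => x _; rewrite lee_fin sumr_ge0// => k _.
    by rewrite mulr_ge0.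
  under eq_integral do rewrite -sumEFin.
  rewrite ge0_integral_sum//; last 2 first.
  - by move=> k; exact/measurable_EFinP.
  - by move=> k x _; rewrite lee_fin mulr_ge0.
  apply: lte_sum_pinfty => k _; apply: le_lt_trans Y0oo.
  rewrite -(martingale_integral k); apply: ge0_le_integral => //.
  - by move=> x _; rewrite lee_fin mulr_ge0.
  - exact/measurable_EFinP.
  - exact/measurable_EFinP.
  - by move=> x _; rewrite lee_fin ler_piMl// /h lern1 leq_b1.
rewrite -(leeD2rE _ _ Sfin) -ge0_integralD//; first last.
- by apply/measurable_EFinP; apply: measurable_sum.
- by move=> x _; rewrite lee_fin sumr_ge0// => k _; rewrite mulr_ge0.
- by apply/measurable_EFinP; apply: measurable_funM => //; exact: measurable_upcrossings.
- by move=> x _; rewrite lee_fin mulr_ge0// subr_ge0 ltW.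
have aE : (\int[P]_x a%:E = a%:E)%E.
  by rewrite integral_cst// [X in (_ * X)%E]probability_setT mule1.
rewrite -intS addeC -[X in (_ <= _ + X)%E]aE.
rewrite -ge0_integralD//; last 2 first.
- by move=> x _; rewrite lee_fin sumr_ge0// => k _; rewrite mulr_ge0.
- by apply/measurable_EFinP; apply: measurable_sum.
apply: ge0_le_integral => //.
- move=> x _; rewrite -EFinD lee_fin addr_ge0//.
    by rewrite mulr_ge0// subr_ge0 ltW.
  by rewrite sumr_ge0// => k _; rewrite mulr_ge0.
- apply: emeasurable_funD; apply/measurable_EFinP; last exact: measurable_sum.
  by apply: measurable_funM => //; exact: measurable_upcrossings.
- by apply: emeasurable_funD => //; apply/measurable_EFinP; exact: measurable_sum.
- by move=> x _; rewrite -EFinD lee_fin; exact: upcrossings_gain.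
Qed.

Lemma upcrossings_ndecr a c (y : nat -> R) m n : (m <= n)%N ->
  (upcrossings a c y m <= upcrossings a c y n)%N.
Proof. by move=> /subnKC <-; rewrite /upcrossings big_split_ord leq_addr. Qed.

(** The expected counts are bounded uniformly in [n], so their lower limit is almost surely finite;
    as the count grows with [n], this lower limit bounds all its terms. *)
Lemma ae_upcrossings_bounded (a c : R) : 0 <= a -> a < c ->
  {ae P, forall x, exists K, forall n, (upcrossings a c (Y ^~ x) n <= K)%N}.
Proof.
move=> a0 ac; have ca : 0 < c - a by rewrite subr_gt0.
have : {ae P, forall x,
    (limn_einf (fun n => ((c - a) * (upcrossings a c (Y ^~ x) n)%:R)%:E) < +oo)%E}.
  apply: (@ae_limn_einf_lty _ _ _ _
    (fun n x => (c - a) * (upcrossings a c (Y ^~ x) n)%:R) a).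
  - by move=> n; apply: measurable_funM => //; exact: measurable_upcrossings.
  - by move=> n x; rewrite mulr_ge0// ltW.
  - by move=> n; exact: expected_upcrossings.
apply: filterS => x; set l := limn_einf _ => loo.
have lfin : l \is a fin_num.
  rewrite ge0_fin_numE//; apply: (@limn_einf_ge _ _ _ 0%N) => n _.
  by rewrite lee_fin mulr_ge0// ltW.
exists (Num.truncn (fine l / (c - a))).+1 => n.
rewrite -(ler_nat R); apply: ltW; apply: le_lt_trans (truncnS_gt _).
rewrite ler_pdivlMr// mulrC -lee_fin fineK//.
apply: (@limn_einf_ge _ _ _ n) => k nk.
by rewrite lee_fin ler_pM2l// ler_nat upcrossings_ndecr.
Qed.

Theorem nonnegative_martingale_cvg : {ae P, forall x, cvgn (Y ^~ x)}.
Proof.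
pose pairs (p q : rat) := 0 < (ratr p : R) < ratr q.
have up : {ae P, forall x, forall p q : rat, pairs p q ->
    exists K, forall n, (upcrossings (ratr p) (ratr q) (Y ^~ x) n <= K)%N}.
  have : {ae P, forall x (pq : rat * rat), pairs pq.1 pq.2 ->
      exists K, forall n, (upcrossings (ratr pq.1) (ratr pq.2) (Y ^~ x) n <= K)%N}.
    apply: ae_forall_countable => -[p q] /=.
    have [/andP[p0 pq]|npq] := boolP (pairs p q); last by apply: aeW.
    apply: filterS (@ae_upcrossings_bounded (ratr p) (ratr q) (ltW p0) pq).
    by move=> x h _.
  by apply: filterS => x H p q; exact: (H (p, q)).
have fin : {ae P, forall x, (limn_einf (fun n => (Y n x)%:E) < +oo)%E}.
  apply: (@ae_limn_einf_lty _ _ _ P Y (fine (\int[P]_x (Y 0%N x)%:E)%E)) => // n.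
  rewrite martingale_integral fineK// ge0_fin_numE//.
  by apply: integral_ge0 => x _; rewrite lee_fin.
by apply: filterS2 up fin => x upx finx; exact: bounded_upcrossings_cvg.
Qed.

End nonnegative_martingale.

(** * Invariant measures dominated by an ergodic one *)

Section ergodic_uniqueness.
Context d (T : measurableType d) (R : realType).
Variables (nu : probability T R) (mu : {finite_measure set T -> \bar R}).
Variable shift : T -> T.
Hypothesis mshift : measurable_fun setT shift.
Hypothesis nu_inv : forall A, measurable A -> nu (shift @^-1` A) = nu A.
Hypothesis mu_inv : forall A, measurable A -> mu (shift @^-1` A) = mu A.
Hypothesis nu_erg : forall A, measurable A -> shift @^-1` A = A ->
  nu A = 0%E \/ nu A = 1%E.
Hypothesis mu_nu : forall A, measurable A -> nu A = 0%E -> mu A = 0%E.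

(** The constant for which the signed measure [k] = [mu] - [c] [nu] has total mass zero, [nu] being
    a probability. It remains to show that [k] vanishes. *)
Let c := fine (mu setT).
Let k A := fine (mu A) - c * fine (nu A).

Let fine_measureU (m : {finite_measure set T -> \bar R}) A B :
  measurable A -> measurable B ->
  fine (m (A `|` B)) + fine (m (A `&` B)) = fine (m A) + fine (m B).
Proof.
move=> mA mB; have mAB := measurableI _ _ mA mB.
rewrite measureUfinl//; last by rewrite -ge0_fin_numE// fin_num_measure.
rewrite fineB ?fin_numD ?fin_num_measure// fineD ?fin_num_measure//.
by rewrite subrK.
Qed.

Let kUI A B : measurable A -> measurable B ->
  k (A `|` B) + k (A `&` B) = k A + k B.
Proof.
move=> mA mB; rewrite /k.
have := fine_measureU mu mA mB.
have /(congr1 ( *%R c)) := fine_measureU nu mA mB; rewrite !mulrDr; lra.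
Qed.

Let k_cvg (m : {finite_measure set T -> \bar R}) (F : nat -> set T) A :
  measurable A -> m (F n) @[n --> \oo] --> m A ->
  fine (m (F n)) @[n --> \oo] --> fine (m A).
Proof.
move=> mA; rewrite -[X in _ --> X](@fineK _ (m A)) ?fin_num_measure//.
by move/fine_cvg.
Qed.

Let k_bigcup (F : nat -> set T) : (forall n, measurable (F n)) ->
  nondecreasing_seq F -> k (F n) @[n --> \oo] --> k (\bigcup_n F n).
Proof.
move=> mF ndF; have mU : measurable (\bigcup_n F n) by exact: bigcupT_measurable.
apply: cvgB; first by apply: k_cvg => //; exact: nondecreasing_cvg_mu.
by apply: cvgMr; apply: (@k_cvg nu) => //; exact: nondecreasing_cvg_mu.
Qed.

Let k_bigcap (F : nat -> set T) : (forall n, measurable (F n)) ->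
  nonincreasing_seq F -> k (F n) @[n --> \oo] --> k (\bigcap_n F n).
Proof.
move=> mF ndF; have mU : measurable (\bigcap_n F n) by exact: bigcapT_measurable.
apply: cvgB; first by apply: k_cvg => //; apply: nonincreasing_cvg_mu => //;
  rewrite -ge0_fin_numE// fin_num_measure.
by apply: cvgMr; apply: (@k_cvg nu) => //; apply: nonincreasing_cvg_mu => //;
  rewrite -ge0_fin_numE// fin_num_measure.
Qed.

(** Removing from [A] its part in the negative set and then adding the rest of the positive set can
    only increase the charge. *)
Let k_hahn : exists2 P, measurable P & forall A, measurable A -> k A <= k P.
Proof.
pose kappa : {charge set T -> \bar R} := cadd (charge_of_finite_measure mu)
  (cscale (- c) (charge_of_finite_measure nu)).
have kE A : measurable A -> kappa A = (k A)%:E.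
  move=> mA; rewrite -[LHS]/(mu A + (- c)%:E * nu A)%E /k.
  rewrite EFinB EFinM EFinN mulNe.
  by congr (_ - _ * _)%E; rewrite fineK ?fin_num_measure.
have [P [N [[mP P0] [mN N0] PN PIN]]] := Hahn_decomposition kappa.
exists P => // A mA; rewrite -lee_fin -!kE//.
have -> : P = (A `&` P) `|` (P `\` A).
  by rewrite setIC setUIDK.
have -> : kappa A = (kappa (A `&` P) + kappa (A `&` N))%E.
  rewrite -chargeU//; [|exact: measurableI|exact: measurableI|].
  - by rewrite -setIUr PN setIT.
  - by rewrite setIACA PIN setI0.
rewrite chargeU//; [|exact: measurableI|exact: measurableD|].
- rewrite leeD2l// (@le_trans _ _ 0%E)//.
  + by apply: N0 => //; exact: measurableI.
  + by apply: P0 => //; exact: measurableD.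
- by apply/seteqP; split => // x [[Ax _] [_ /(_ Ax)]].
Qed.

(* A Hahn set [P] of [mu - c nu] has maximal charge, hence so have its preimages
   by the shift, their unions and their intersections.  The upper limit of these
   preimages is strictly invariant, so the maximal charge is zero by ergodicity. *)
Lemma ergodic_dominated_measureE A : measurable A ->
  mu A = (mu setT * nu A)%E.
Proof.
have [P mP Pmax] := k_hahn.
have kinv B : measurable B -> k (shift @^-1` B) = k B.
  by move=> mB; rewrite /k mu_inv// nu_inv.
have mpre B : measurable B -> measurable (shift @^-1` B).
  by move=> mB; rewrite -[X in measurable X]setTI; exact: mshift.
pose F n := iter n (fun B => shift @^-1` B) P.
have mF n : measurable (F n) by elim: n => //= n; exact: mpre.
have kF n : k (F n) = k P by elim: n => //= n <-; rewrite kinv.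
(* The charges of the union and of the intersection add up to twice the maximum, and neither exceeds
   it. *)
have maxU B C : measurable B -> measurable C -> k B = k P -> k C = k P ->
    k (B `|` C) = k P.
  move=> mB mC kB kC; have := kUI mB mC.
  have := Pmax _ (measurableU _ _ mB mC); have := Pmax _ (measurableI _ _ mB mC).
  lra.
pose G n := \bigcup_i F (n + i)%N.
have mG n : measurable (G n) by exact: bigcupT_measurable.
have kG n : k (G n) = k P.
  pose H j := \big[setU/set0]_(i < j.+1) F (n + i)%N.
  have mH j : measurable (H j) by exact: bigsetU_measurable.
  have kH j : k (H j) = k P.
    elim: j => [|j IH]; first by rewrite /H big_ord_recr big_ord0 /= set0U kF.
    by rewrite /H big_ord_recr; exact: (maxU _ _ (mH j) (mF _) IH (kF _)).
  have GH : G n = \bigcup_j H j.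
    apply/seteqP; split=> [x [i _ Fx]|x [j _]].
      by exists i => //; rewrite /H big_ord_recr /=; right.
    by rewrite /H -(bigcup_mkord _ (fun i => F (n + i)%N)) => -[i _ Fx]; exists i.
  rewrite GH; have : k (H n) @[n --> \oo] --> k (\bigcup_n H n).
    apply: k_bigcup => // i j ij; apply/subsetPset.
    rewrite /H -!(bigcup_mkord _ (fun i => F (n + i)%N)) => x [l /= li Fx].
    by exists l => //=; exact: leq_trans li _.
  under eq_fun do rewrite kH.
  by move=> /cvg_lim <- //; rewrite lim_cst.
pose S := \bigcap_n G n.
have mS : measurable S by exact: bigcapT_measurable.
have niG : nonincreasing_seq G.
  move=> i j ij; apply/subsetPset => x [l _ Fx]; exists (j - i + l)%N => //.
  by rewrite addnA subnKC.
have kS : k S = k P.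
  have := k_bigcap mG niG.
  under eq_fun do rewrite kG.
  by move=> /cvg_lim <- //; rewrite lim_cst.
(* The preimage of [S] is the intersection of the [G n] from [n = 1] on; as [G] decreases, leaving
   out [G 0] changes nothing. *)
have SS : shift @^-1` S = S.
  have GS n : shift @^-1` (G n) = G n.+1 by [].
  rewrite /S preimage_bigcap; apply/seteqP; split=> x Gx n _.
    by have /subsetPset := niG _ _ (leqnSn n); apply; rewrite -GS; exact: Gx.
  by rewrite GS; exact: Gx.
have kT : k setT = 0.
  by rewrite /k -/c probability_setT mulr1 subrr.
(* If [S] is [nu]-null, it is [mu]-null as well; if its complement is, then [S] has the charge of
   the whole space, which is zero. *)
have k0 : k P = 0.
  rewrite -kS; have [nuS|nuS] := nu_erg mS SS.
    by rewrite /k nuS mu_nu// mulr0 subrr.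
  have nuC : nu (~` S) = 0%E by rewrite probability_setC// nuS subee.
  have kC : k (~` S) = 0.
    by rewrite /k nuC mu_nu ?mulr0 ?subrr//; exact: measurableC.
  have := kUI mS (measurableC mS).
  have kset0 : k set0 = 0 by rewrite /k !measure0 mulr0 subrr.
  by rewrite setUv setICr kT kC kset0 addr0; lra.
have k_le0 B : measurable B -> k B <= 0 by move=> mB; rewrite -k0; exact: Pmax.
move=> mA.
(* The charges of [A] and of its complement are both at most zero and have sum zero. *)
have kA : k A = 0.
  have := kUI mA (measurableC mA); rewrite setUv setICr kT.
  have -> : k set0 = 0 by rewrite /k !measure0 mulr0 subrr.
  by have := k_le0 _ mA; have := k_le0 _ (measurableC mA); lra.
rewrite -[LHS]fineK ?fin_num_measure// -[in RHS](fineK (fin_num_measure nu A mA)).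
rewrite -[mu setT]fineK ?fin_num_measure// -EFinM -/c; congr EFin.
by move: kA => /eqP; rewrite subr_eq0 => /eqP.
Qed.

End ergodic_uniqueness.

(** * Cylinders of the sequence space *)

Lemma measure_finite_partition d (T : measurableType d) (R : realType)
    (m : {measure set T -> \bar R}) (I : finType) (F : I -> set T) :
  (forall i, measurable (F i)) -> trivIset setT F ->
  m (\big[setU/set0]_i F i) = (\sum_i m (F i))%E.
Proof.
move=> mF tF; rewrite -bigcup_seq measure_fin_bigcup//.
- by rewrite -fsbig_seq// index_enum_uniq.
- exact: sub_trivIset tF.
Qed.

Section sequence_space.
Context (b : nat) (hb : (1 < b)%N).
Notation word := (seq (letter hb)).
Implicit Types (u v : word) (x : Sigma hb).

Definition word_cylinder u : set (Sigma hb) :=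
  [set x | initial_word x (size u) = u].

Lemma size_initial_word x n : size (initial_word x n) = n.
Proof. exact: size_mkseq. Qed.

Lemma initial_wordS x n : initial_word x n.+1 = rcons (initial_word x n) (x n).
Proof. by rewrite /initial_word /mkseq -addn1 iotaD map_cat cats1. Qed.

Lemma take_initial_word x n k : (k <= n)%N ->
  take k (initial_word x n) = initial_word x k.
Proof.
by move=> kn; rewrite /initial_word /mkseq -map_take take_iota (minn_idPl kn).
Qed.

Lemma initial_word_cylinder x n : word_cylinder (initial_word x n) x.
Proof. by rewrite /word_cylinder /= size_initial_word. Qed.

Lemma word_cylinder_nil : word_cylinder [::] = setT.
Proof. by apply/seteqP; split. Qed.

Lemma word_cylinder_rcons u i x :
  word_cylinder (rcons u i) x <-> word_cylinder u x /\ x (size u) = i.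
Proof.
rewrite /word_cylinder /= size_rcons initial_wordS; split.
  by move/rcons_inj => [-> ->].
by move=> [-> ->].
Qed.

Lemma word_cylinder_cons i u x :
  word_cylinder (i :: u) x <-> x 0%N = i /\ word_cylinder u (left_shift x).
Proof.
rewrite /word_cylinder /= /initial_word /mkseq /= -[1%N]addn0 iotaDl -map_comp.
by split=> [[-> ->]|[-> ->]].
Qed.

Lemma open_coordinate n i : open [set x : Sigma hb | x n = i].
Proof.
pose p : Sigma hb -> discrete_topology (letter hb) := fun x => x n.
have [cp _] := continuousP p.
apply: (cp _ [set i]); last exact: discrete_open.
exact: (@proj_continuous nat (fun=> discrete_topology (letter hb)) n).
Qed.

Lemma open_word_cylinder u : open (word_cylinder u).
Proof.
elim/last_ind: u => [|u i IH]; first by rewrite word_cylinder_nil; exact: openT.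
rewrite (_ : word_cylinder _ = word_cylinder u `&` [set x | x (size u) = i]).
  by apply: openI => //; exact: open_coordinate.
by apply/seteqP; split=> x /word_cylinder_rcons.
Qed.

Lemma measurable_word_cylinder u : measurable (word_cylinder u).
Proof. by apply: sub_sigma_algebra; exact: open_word_cylinder. Qed.

(** The cylinders of the prefixes of [x] generate a filter, and convergence to [x] in the product
    topology can be tested on coordinates: the prefix of length [N.+1] fixes coordinate [N]. *)
Lemma nbhs_word_cylinder x (A : set (Sigma hb)) : nbhs x A ->
  exists n, word_cylinder (initial_word x n) `<=` A.
Proof.
pose F := filter_from setT (fun n => word_cylinder (initial_word x n)).
have FF : Filter F.
  apply: filter_from_filter; first by exists 0%N.
  move=> n k _ _; exists (maxn n k) => // y.
  rewrite /word_cylinder /= !size_initial_word => yx.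
  rewrite -(take_initial_word y (leq_maxl n k)) -(take_initial_word y (leq_maxr n k)).
  by rewrite yx !take_initial_word ?leq_maxl ?leq_maxr.
have Fx : F --> x.
  apply/cvg_sup => N U [V] [[W] oW <-] WfN WU.
  rewrite nbhs_simpl; exists N.+1 => // y.
  rewrite /word_cylinder /mkset size_initial_word !initial_wordS => /rcons_inj[_ yN].
  by apply: WU; rewrite /= yN.
by move=> /Fx [n _ nA]; exists n.
Qed.

(** Two cylinders are nested or disjoint, so adding the empty set gives a pi-system. *)
Definition word_cylinders : set (set (Sigma hb)) :=
  [set A | A = set0 \/ exists u, A = word_cylinder u].

Lemma word_cylinder_sub u v : take (size u) v = u ->
  word_cylinder v `<=` word_cylinder u.
Proof.
move=> uv x xv; rewrite /word_cylinder /= -[RHS]uv -[in RHS]xv.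
rewrite take_initial_word//.
by rewrite -uv size_take; case: ltnP => // /ltnW.
Qed.

Lemma setI_closed_word_cylinders : setI_closed word_cylinders.
Proof.
suff H u v : (size u <= size v)%N ->
    word_cylinders (word_cylinder u `&` word_cylinder v).
  move=> _ _ [->|[u ->]] [->|[v ->]]; rewrite ?set0I ?setI0; try by left.
  by have [uv|/ltnW vu] := leqP (size u) (size v); [|rewrite setIC]; exact: H.
move=> uv; have [tuv|tuv] := eqVneq (take (size u) v) u.
  by right; exists v; rewrite setIC; apply: setIidl; exact: word_cylinder_sub.
left; apply/seteqP; split=> // x [xu xv]; apply/negP: tuv; rewrite negbK.
by rewrite -[in take _ _]xv take_initial_word//; apply/eqP.
Qed.

(** An open set is the union of the cylinders that it contains, and there are countably many
    words. *)
Lemma measurable_word_cylindersE :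
  @measurable _ (Sigma hb) = <<s word_cylinders >>.
Proof.
apply/seteqP; split; last first.
  apply: smallest_sub; first exact: sigma_algebra_measurable.
  by move=> _ [->|[u ->]]; [exact: measurable0 | exact: measurable_word_cylinder].
apply: smallest_sub; first exact: smallest_sigma_algebra.
move=> A oA.
pose g n : set (Sigma hb) := if @unpickle word n is Some u then
  (if `[< word_cylinder u `<=` A >] then word_cylinder u else set0) else set0.
have -> : A = \bigcup_n g n.
  apply/seteqP; split=> [x Ax|x [n _]].
    have [n nA] := nbhs_word_cylinder (open_nbhs_nbhs (conj oA Ax)).
    exists (pickle (initial_word x n)) => //; rewrite /g pickleK.
    by case: asboolP => // _; exact: initial_word_cylinder.
  rewrite /g; case: unpickle => // u; case: asboolP => // uA xu; exact: uA.
have [sG0 _ sGU] := smallest_sigma_algebra setT word_cylinders.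
apply: sGU => n; rewrite /g.
case: unpickle => [u|]; last exact: sG0.
case: asboolP => _; last exact: sG0.
by apply: sub_sigma_algebra; right; exists u.
Qed.

Lemma Sigma_measure_unique (R : realType)
    (m1 m2 : {measure set (Sigma hb) -> \bar R}) :
  (forall u, m1 (word_cylinder u) = m2 (word_cylinder u)) ->
  (m1 setT < +oo)%E -> forall A, measurable A -> m1 A = m2 A.
Proof.
move=> m12 m1oo A mA; apply: (measure_unique word_cylinders (fun=> setT)) => //.
- exact: measurable_word_cylindersE.
- exact: setI_closed_word_cylinders.
- by move=> _; right; exists [::]; rewrite word_cylinder_nil.
- by apply/seteqP; split => // x _; exists 0%N.
- by move=> _ [->|[u ->]]; [rewrite !measure0|exact: m12].
Qed.

Lemma measurable_to_Sigma d (T : measurableType d) (f : T -> Sigma hb) :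
  (forall u, measurable (f @^-1` word_cylinder u)) -> measurable_fun setT f.
Proof.
move=> mf; apply: (@measurability _ _ _ _ setT f word_cylinders).
  exact: measurable_word_cylindersE.
move=> _ [_ [->|[u ->]] <-]; rewrite setTI ?preimage_set0//.
Qed.

Lemma preimage_left_shift u : @left_shift b hb @^-1` word_cylinder u =
  \big[setU/set0]_(i : letter hb) word_cylinder (i :: u).
Proof.
apply/seteqP; split=> [x xu|x].
  by rewrite (bigD1 (x 0%N))//=; left; apply/word_cylinder_cons.
elim/big_ind: _ => //= [A B HA HB []//|i _].
by move=> /word_cylinder_cons[].
Qed.

Lemma measurable_left_shift : measurable_fun setT (@left_shift b hb).
Proof.
apply: measurable_to_Sigma => u; rewrite preimage_left_shift.
by apply: bigsetU_measurable => i _; exact: measurable_word_cylinder.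
Qed.

Lemma word_cylinder_rconsE u : word_cylinder u =
  \big[setU/set0]_(i : letter hb) word_cylinder (rcons u i).
Proof.
apply/seteqP; split=> [x xu|x].
  by rewrite (bigD1 (x (size u)))//=; left; apply/word_cylinder_rcons.
elim/big_ind: _ => //= [A B HA HB []//|i _].
by move=> /word_cylinder_rcons[].
Qed.

Lemma measure_word_cylinder (R : realType)
    (m : {measure set (Sigma hb) -> \bar R}) u :
  m (word_cylinder u) = (\sum_(i : letter hb) m (word_cylinder (rcons u i)))%E.
Proof.
rewrite {1}word_cylinder_rconsE measure_finite_partition//.
- by move=> i; exact: measurable_word_cylinder.
- move=> i j _ _ [x [/word_cylinder_rcons[_ xi] /word_cylinder_rcons[_ xj]]].
  by rewrite -xi xj.
Qed.

Lemma measure_preimage_left_shift (R : realType)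
    (m : {measure set (Sigma hb) -> \bar R}) u :
  m (@left_shift b hb @^-1` word_cylinder u) =
  (\sum_(i : letter hb) m (word_cylinder (i :: u)))%E.
Proof.
rewrite preimage_left_shift measure_finite_partition//.
- by move=> i; exact: measurable_word_cylinder.
- move=> i j _ _ [x [/word_cylinder_cons[xi _] /word_cylinder_cons[xj _]]].
  by rewrite -xi xj.
Qed.

Section branch.
Variable next : word -> letter hb.

(** A path descending from the root. It serves both for Koenig's lemma and for the address of a real
    number in the subdivided interval. *)
Fixpoint branch n : word :=
  if n is k.+1 then rcons (branch k) (next (branch k)) else [::].

Definition branch_limit : Sigma hb := fun n => next (branch n).

Lemma initial_word_branch n : initial_word branch_limit n = branch n.
Proof. by elim: n => // n IH; rewrite initial_wordS IH. Qed.

End branch.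

(* Koenig's lemma stands in for the compactness of [Sigma]. *)
Lemma continuous_uniform_words (R : realType) (f : Sigma hb -> R) : continuous f ->
  forall e, 0 < e -> exists n, forall x y, initial_word x n = initial_word y n ->
  `|f x - f y| < e.
Proof.
move=> cf e e0.
pose bad u n := exists x y, [/\ word_cylinder u x, word_cylinder u y,
  initial_word x n = initial_word y n & e <= `|f x - f y|].
apply: contrapT => nf.
have bad0 : forall n, bad [::] n.
  move=> n; apply: contrapT => nb; apply: nf; exists n => x y xy.
  by rewrite ltNge; apply/negP => exy; apply: nb; exists x, y.
have badS u : (forall n, bad u n) -> exists i, forall n, bad (rcons u i) n.
  move=> bu; apply: contrapT => /forallNP nb.
  have {}nb i : exists n, ~ bad (rcons u i) n by exact/existsNP/nb.
  pose N i := projT1 (cid (nb i)).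
  (* Beyond [M] no child of [u] would be bad. The term [(size u).+1] makes [x] and [y] agree on the
     letter after [u], so that both lie in the same child. *)
  pose M := maxn (size u).+1 (\max_i N i).
  have [x [y [xu yu xy exy]]] := bu M.
  apply: (projT2 (cid (nb (x (size u))))); rewrite -/(N _).
  exists x, y; split=> //.
  - exact/word_cylinder_rcons.
  - apply/word_cylinder_rcons; split=> //.
    have : initial_word x (size u).+1 = initial_word y (size u).+1.
      by rewrite -(@take_initial_word x M) ?leq_maxl// xy take_initial_word// leq_maxl.
    by rewrite !initial_wordS => /rcons_inj[].
  - have NM : (N (x (size u)) <= M)%N.
      by rewrite leq_max; apply/orP; right; exact: leq_bigmax.
    by rewrite -(@take_initial_word x M)// xy take_initial_word.
pose next u := xget point [set i | forall n, bad (rcons u i) n].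
have bad_branch k n : bad (branch next k) n.
  elim: k n => [|k IH] n //=.
  by have /(xgetPex point) := badS _ IH; exact.
pose x := branch_limit next.
(* By continuity at the limit of the bad path, [f] is within [e / 2] of [f x] on a whole cylinder of
   that path, whose word is therefore not bad. *)
have : nbhs x (f @^-1` (ball (f x) (e / 2))).
  by apply: cf; apply: nbhsx_ballx; rewrite divr_gt0.
move=> /nbhs_word_cylinder[n nx].
have [y [z [yx zx _]]] := bad_branch n 0%N.
apply/negP; rewrite -ltNge.
rewrite -initial_word_branch in yx zx.
have := nx _ yx; have := nx _ zx; rewrite /= /ball /= => fz fy.
rewrite -(subrKA (f x)) (le_lt_trans (ler_normD _ _))// [e]splitr.
by rewrite ltrD// distrC.
Qed.

End sequence_space.

(** * Finite measures from additive functions on words *)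

Section tree_functions.
Context (b : nat) (hb : (1 < b)%N) (R : realType).
Notation word := (seq (letter hb)).
Implicit Types (m : word -> R) (u v : word).

Definition tree_additive m := forall u, m u = \sum_(i : letter hb) m (rcons u i).

(* [m] lays the cylinders of each length as consecutive intervals, in
   lexicographic order, the interval of a word being subdivided by those of its
   children: the cylinder measure is the image of Lebesgue measure. *)
Section subdivision.
Variable m : word -> R.
Hypotheses (m_ge0 : forall u, 0 <= m u) (m_add : tree_additive m).

Definition sibling_sum u k := \sum_(j : letter hb | (j < k)%N) m (rcons u j).

Definition left_end u :=
  \sum_(k < size u) sibling_sum (take k u) (nth point u k).

(** Half-open, so that the children of a word partition its interval exactly, those of mass zero
    being empty. *)
Definition subinterval u : set R := `[left_end u, left_end u + m u[%classic.

Lemma left_end_rcons u i : left_end (rcons u i) = left_end u + sibling_sum u i.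
Proof.
rewrite /left_end size_rcons big_ord_recr /= -cats1 take_size_cat// nth_cat.
rewrite ltnn subnn; congr (_ + _); apply: eq_bigr => k _.
by rewrite take_cat nth_cat ltn_ord.
Qed.

Lemma sibling_sum0 u : sibling_sum u 0 = 0.
Proof. by rewrite /sibling_sum big_pred0. Qed.

Lemma sibling_sumS u (i : letter hb) :
  sibling_sum u i.+1 = sibling_sum u i + m (rcons u i).
Proof.
rewrite /sibling_sum (bigD1 i)//= addrC; congr (_ + _).
by apply: eq_bigl => j; rewrite ltnS ltn_neqAle andbC.
Qed.

Lemma sibling_sum_all u : sibling_sum u b = m u.
Proof. by rewrite m_add /sibling_sum; apply: eq_bigl => j; rewrite ltn_ord. Qed.

Lemma le_sibling_sum u k l : (k <= l)%N -> sibling_sum u k <= sibling_sum u l.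
Proof.
move=> kl; rewrite /sibling_sum [leRHS](bigID (fun j : letter hb => (j < k)%N))/=.
rewrite [X in _ <= X + _](eq_bigl (fun j : letter hb => (j < k)%N)).
  by rewrite lerDl sumr_ge0.
by move=> j; rewrite andb_idl// => /leq_trans; exact.
Qed.

Lemma in_subinterval u t :
  subinterval u t <-> left_end u <= t /\ t < left_end u + m u.
Proof. by rewrite /subinterval /= in_itv/=; split=> /andP. Qed.

Lemma subinterval_rcons u i : subinterval (rcons u i) `<=` subinterval u.
Proof.
move=> t /in_subinterval; rewrite left_end_rcons -addrA -sibling_sumS => -[t1 t2].
have s0 : 0 <= sibling_sum u i by rewrite -(sibling_sum0 u) le_sibling_sum.
have s1 : sibling_sum u i.+1 <= m u by rewrite -sibling_sum_all le_sibling_sum.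
by apply/in_subinterval; split; lra.
Qed.

Lemma subinterval_nil u : subinterval u `<=` subinterval [::].
Proof.
elim/last_ind: u => // u i IH; apply: subset_trans IH.
exact: subinterval_rcons.
Qed.

Lemma subinterval_child u t : subinterval u t ->
  exists i, subinterval (rcons u i) t.
Proof.
move=> /in_subinterval[t1 t2].
(* The child is found by scanning the partial sums of the siblings downwards from their total: it is
   the one where the right end first passes [t]. *)
suff: forall k, (k <= b)%N -> t < left_end u + sibling_sum u k ->
    exists i, subinterval (rcons u i) t.
  by move=> /(_ b (leqnn b)); rewrite sibling_sum_all; exact.
elim=> [_|k IH kb]; first by rewrite sibling_sum0 addr0 ltNge t1.
have [tk _|tk tk1] := ltP t (left_end u + sibling_sum u k).
  exact: IH (ltnW kb) tk.
exists (Ordinal kb : letter hb); apply/in_subinterval.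
by rewrite left_end_rcons -addrA -sibling_sumS; split.
Qed.

Lemma subinterval_inj u t i j :
  subinterval (rcons u i) t -> subinterval (rcons u j) t -> i = j.
Proof.
wlog ij : i j / (i <= j)%N.
  move=> H; have [ij|/ltnW ji] := leqP i j; first exact: H.
  by move=> ti tj; apply/esym; exact: H tj ti.
move=> /in_subinterval[_ ti] /in_subinterval[tj _].
apply/val_inj/eqP; rewrite eqn_leq ij leqNgt; apply/negP => ltij.
have := le_sibling_sum u ltij.
by move: ti tj; rewrite !left_end_rcons -addrA -sibling_sumS => ti tj; lra.
Qed.

Definition child_of t u : letter hb :=
  odflt point [pick i | `[< subinterval (rcons u i) t >]].

Definition address t : Sigma hb := branch_limit (child_of t).

Lemma child_ofP t u : subinterval u t -> subinterval (rcons u (child_of t u)) t.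
Proof.
move=> /subinterval_child[i ti]; rewrite /child_of.
case: pickP => [j /asboolP//|/(_ i)]/=.
by move=> /asboolP.
Qed.

Lemma addressP t u : subinterval [::] t ->
  word_cylinder u (address t) <-> subinterval u t.
Proof.
move=> t0; have tn n : subinterval (branch (child_of t) n) t.
  by elim: n => //= n; exact: child_ofP.
rewrite /word_cylinder /= /address initial_word_branch; split=> [<-//|].
elim/last_ind: u => // u i IH ti.
have tu : subinterval u t by exact: subinterval_rcons ti.
rewrite size_rcons /= IH//; congr rcons.
by apply: subinterval_inj ti; exact: child_ofP.
Qed.

(** No child contains such a [t], so the default letter is chosen at each step. The address is thus
    constant off the root interval, which makes it measurable on the whole line. *)
Lemma address_out t : ~ subinterval [::] t ->
  address t = branch_limit (fun=> point : letter hb).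
Proof.
move=> t0; congr branch_limit; apply/funext => u; rewrite /child_of.
case: pickP => // i /asboolP /subinterval_nil //.
Qed.

Lemma measurable_subinterval u : measurable (subinterval u).
Proof. exact: measurable_itv. Qed.

Lemma measurable_address : measurable_fun setT address.
Proof.
apply: measurable_to_Sigma => u.
rewrite (_ : _ @^-1` _ = subinterval u `|` (~` subinterval [::] `&`
    [set t | word_cylinder u (branch_limit (fun=> point : letter hb))])).
  apply: measurableU; first exact: measurable_subinterval.
  have [h|h] := pselect (word_cylinder u (branch_limit (fun=> point : letter hb))).
    rewrite (_ : [set t | _] = setT); last by apply/seteqP; split.
    by rewrite setIT; apply: measurableC; exact: measurable_subinterval.
  rewrite (_ : [set t | _] = set0) ?setI0//.
  by apply/seteqP; split.
apply/seteqP; split=> [t|t [ut|[t0 ut]]].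
- have [t0|t0] := pselect (subinterval [::] t).
    by move=> /(addressP u t0); left.
  by rewrite /preimage /= address_out//; right.
- by apply/(addressP _ (subinterval_nil ut)).
- by rewrite /preimage /= address_out.
Qed.

(** Countable additivity is inherited from Lebesgue measure, restricted to the root interval,
    through the image by [address]. *)
Lemma tree_measure_exists : exists M : {finite_measure set (Sigma hb) -> \bar R},
  forall u, M (word_cylinder u) = (m u)%:E.
Proof.
pose M : {measure set (Sigma hb) -> \bar R} :=
  @pushforward _ _ _ _ _
    (mrestr lebesgue_measure (measurable_subinterval [::])) address.
have ME u : M measurable_address (word_cylinder u) = (m u)%:E.
  rewrite -[LHS]/(lebesgue_measure
    (address @^-1` word_cylinder u `&` subinterval [::])).
  rewrite (_ : _ `&` _ = subinterval u).
    rewrite /subinterval lebesgue_measure_itv/= lte_fin ltrDl lt_def m_ge0 andbT.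
    by case: eqVneq => [->//|_] /=; rewrite -EFinB addrAC subrr add0r.
  apply/seteqP; split=> [t [ut t0]|t ut]; first exact/(addressP _ t0).
  by have t0 := subinterval_nil ut; split=> //; exact/(addressP _ t0).
have fM : fin_num_fun (M measurable_address).
  apply: lty_fin_num_fun.
  by rewrite -(word_cylinder_nil hb) ME ltry.
pose fM' := Measure_isFinite.Build _ _ _ (M measurable_address) fM.
pose M' : {finite_measure set (Sigma hb) -> \bar R} :=
  HB.pack (Measure.sort (M measurable_address))
    (Measure.class (M measurable_address)) fM'.
by exists M'.
Qed.

End subdivision.

Lemma tree_additive_measure (nu : {finite_measure set (Sigma hb) -> \bar R}) :
  tree_additive (fun u => fine (nu (word_cylinder u))).
Proof.
move=> u; rewrite measure_word_cylinder sum_fine// => i _.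
by apply: fin_num_measure; exact: measurable_word_cylinder.
Qed.

End tree_functions.

(** * Product laws *)

Section environment.
Context (I : choiceType) (R : realType).

Definition environment : Type := I -> R.

Implicit Types (s : seq I) (B : I -> set R).

Definition cylinder s B : set environment :=
  \big[setI/setT]_(i <- s) [set e | B i (e i)].

Definition cylinders : set (set environment) :=
  [set A | exists s B, [/\ uniq s, forall i, measurable (B i) & A = cylinder s B]].

HB.instance Definition _ := isPointed.Build environment (fun=> 0).
HB.instance Definition _ :=
  Measurable.copy environment (g_sigma_algebraType cylinders).

Lemma cylinderE s B : cylinder s B = [set e | forall i, i \in s -> B i (e i)].
Proof. by rewrite /cylinder -bigcap_seq; apply/seteqP; split. Qed.

Lemma setI_closed_cylinders : setI_closed cylinders.
Proof.
move=> _ _ [s [B [us mB ->]]] [t [C [ut mC ->]]].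
exists (undup (s ++ t)).
exists (fun i => (if i \in s then B i else setT) `&` (if i \in t then C i else setT)).
split; first exact: undup_uniq.
  by move=> i; apply: measurableI; case: ifPn.
rewrite !cylinderE; apply/seteqP; split=> [e [Be Ce] i _ /=|e H].
  by split; case: ifPn => // h; [exact: Be | exact: Ce].
by split=> i ih; have := H i; rewrite mem_undup mem_cat ih ?orbT => /(_ isT)[].
Qed.

Lemma measurable_coordinate i : measurable_fun setT (fun e : environment => e i).
Proof.
move=> _ B mB; rewrite setTI; apply: sub_sigma_algebra.
exists [:: i], (fun=> B); split => //.
by rewrite /cylinder big_seq1.
Qed.

Lemma measurable_cylinder s B : (forall i, measurable (B i)) ->
  measurable (cylinder s B).
Proof.
move=> mB; apply: bigsetI_measurable => i _.
by rewrite -[X in measurable X]setTI; exact: measurable_coordinate.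
Qed.

Lemma measurable_to_environment d (T : measurableType d) (f : T -> environment) :
  (forall i, measurable_fun setT (fun x => f x i)) -> measurable_fun setT f.
Proof.
move=> mf; apply: (@measurability _ _ _ _ setT f cylinders) => //.
move=> _ [_ [s [B [us mB ->]]] <-]; rewrite setTI /cylinder -bigcap_seq preimage_bigcap.
rewrite bigcap_seq; apply: bigsetI_measurable => i _.
by rewrite -[X in measurable X]setTI; exact: mf.
Qed.

Lemma environment_measure_unique (m1 m2 : {measure set environment -> \bar R}) :
  (forall s B, uniq s -> (forall i, measurable (B i)) ->
    m1 (cylinder s B) = m2 (cylinder s B)) ->
  (m1 setT < +oo)%E -> forall A, measurable A -> m1 A = m2 A.
Proof.
move=> m12 m1oo A mA; apply: (measure_unique cylinders (fun=> setT)) => //.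
- exact: setI_closed_cylinders.
- by move=> _; exists [::], (fun=> setT); split; rewrite // /cylinder big_nil.
- by apply/seteqP; split => // x _; exists 0%N.
- by move=> _ [s [B [us mB ->]]]; exact: m12.
Qed.

Definition independent_coordinates (L : set environment -> \bar R) :=
  forall s B, uniq s -> (forall i, measurable (B i)) ->
  L (cylinder s B) = (\prod_(i <- s) L [set e | B i (e i)])%E.

Definition splice (D : pred I) (z : environment * environment) : environment :=
  fun i => if D i then z.1 i else z.2 i.

Definition depends_on (D : pred I) T (f : environment -> T) :=
  forall e e', (forall i, D i -> e i = e' i) -> f e = f e'.

Lemma measurable_splice D : measurable_fun setT (splice D).
Proof.
apply: measurable_to_environment => i; rewrite /splice.
case: (D i); apply: (measurableT_comp (measurable_coordinate i)).
  exact: measurable_fst.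
exact: measurable_snd.
Qed.

Definition reindex (t : I -> I) (e : environment) : environment :=
  fun i => e (t i).

Lemma measurable_reindex t : measurable_fun setT (reindex t).
Proof.
by apply: measurable_to_environment => i; exact: measurable_coordinate.
Qed.

Section independence.
Variable L : probability environment R.
Hypothesis indL : independent_coordinates L.

(* With Tonelli's theorem, this invariance under resampling yields all the
   independence between blocks of coordinates. *)
Lemma pushforward_splice D A : measurable A ->
  pushforward (L \x L)%E (splice D) A = L A.
Proof.
pose m : {measure set environment -> \bar R} :=
  pushforward (L \x L)%E (splice D).
move=> mA; suff : L A = m (measurable_splice D) A by [].
apply: environment_measure_unique mA; last first.
  exact: le_lt_trans (probability_le1 L measurableT) (ltry 1).
move=> s B us mB; rewrite /m /= /pushforward.
have -> : splice D @^-1` (cylinder s B) =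
    cylinder [seq i <- s | D i] B `*` cylinder [seq i <- s | ~~ D i] B.
  rewrite !cylinderE; apply/seteqP; split=> [[e e'] /= H|[e e'] /= [H H'] i si].
    by split=> i; rewrite mem_filter => /andP[Di si]; have := H i si;
       rewrite /splice /=; move: Di => /=; case: (D i).
  rewrite /splice /=; case Di : (D i); [apply: H | apply: H'];
  by rewrite mem_filter ?Di //= Di.
rewrite product_measure1E; [|exact: measurable_cylinder..].
rewrite indL// (bigID D)/= -big_filter -[X in (_ * X)%E = _]big_filter.
by congr (_ * _)%E; apply/esym/indL; rewrite ?filter_uniq.
Qed.

Lemma integral_splice D (f : environment -> \bar R) : measurable_fun setT f ->
  (forall e, 0 <= f e)%E ->
  (\int[L]_e f e = \int[(L \x L)]_z f (splice D z))%E.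
Proof.
move=> mf f0; transitivity (\int[pushforward (L \x L) (splice D)]_e f e)%E.
  apply: eq_measure_integral => [|mS A mA _]; first exact: measurable_splice.
  exact/esym/pushforward_splice.
by rewrite ge0_integral_pushforward//; exact: measurable_splice.
Qed.

(** On a spliced environment [f] sees only the first copy and [g] only the second. *)
Lemma independent_integralM D (f g : environment -> \bar R) :
  measurable_fun setT f -> measurable_fun setT g ->
  (forall e, 0 <= f e)%E -> (forall e, 0 <= g e)%E ->
  depends_on D f -> depends_on (predC D) g ->
  (\int[L]_e (f e * g e) = \int[L]_e f e * \int[L]_e g e)%E.
Proof.
move=> mf mg f0 g0 fD gD.
rewrite (@integral_splice D)//; [|exact: emeasurable_funM|by move=> e; rewrite mule_ge0].
transitivity (\int[(L \x L)]_z (f z.1 * g z.2))%E.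
  apply: eq_integral => z _; congr (_ * _)%E; [apply: fD|apply: gD] => i Di;
  by rewrite /splice; move: Di => /=; case: (D i).
rewrite fubini_tonelli1/=; first last.
- by move=> z; rewrite mule_ge0.
- by apply: emeasurable_funM; apply: measurableT_comp.
under eq_integral do rewrite /fubini_F /= ge0_integralZl//.
by rewrite ge0_integralZr// integral_ge0.
Qed.

Lemma pushforward_reindex (t : I -> I) : injective t ->
  (forall i (B : set R), measurable B ->
    L [set e | B (e (t i))] = L [set e | B (e i)]) ->
  forall A, measurable A -> pushforward L (reindex t) A = L A.
Proof.
move=> tI tL A mA.
pose m : {measure set environment -> \bar R} :=
  pushforward L (reindex t).
suff : L A = m (measurable_reindex t) A by [].
apply: environment_measure_unique mA; last first.
  exact: le_lt_trans (probability_le1 L measurableT) (ltry 1).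
move=> s B us mB; rewrite /m /= /pushforward.
(* Quantifying over the preimages of [j] transports [B] along [t] without an inverse: by injectivity
   there is at most one preimage, and off the range of [t] there is no constraint. *)
pose B' j : set R := [set r | forall i, t i = j -> B i r].
have B'E i : B' (t i) = B i.
  by apply/seteqP; split=> [r /(_ i erefl)//|r Br k /tI ->].
have mB' j : measurable (B' j).
  have [[i <-]|nj] := pselect (exists i, t i = j); first by rewrite B'E.
  rewrite (_ : B' j = setT)//; apply/seteqP; split=> // r _ i ij.
  by exfalso; apply: nj; exists i.
have -> : reindex t @^-1` (cylinder s B) = cylinder (map t s) B'.
  rewrite !cylinderE; apply/seteqP; split=> [e /= H _ /mapP[i si ->]|e H i si].
    by rewrite B'E; exact: H.
  by rewrite -B'E; apply: H; exact: map_f.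
rewrite !indL ?map_inj_uniq// big_map; apply: eq_bigr => i _.
by rewrite B'E tL.
Qed.

End independence.

End environment.

(** * The cascade as a function of its weights *)

Section words.
Context (b : nat) (hb : (1 < b)%N).
Notation word := (seq (letter hb)).
Implicit Types u v : word.

Fixpoint words n : seq word :=
  if n is k.+1 then [seq rcons v i | v <- words k, i <- index_enum (letter hb)]
  else [:: [::]].

Lemma size_words n v : v \in words n -> size v = n.
Proof.
elim: n v => [v|n IH v]; first by rewrite inE => /eqP ->.
by move=> /allpairsP[[u i] /= [/IH un _ ->]]; rewrite size_rcons un.
Qed.

Lemma mem_words v : v \in words (size v).
Proof.
elim/last_ind: v => [|v i IH]; first by rewrite inE.
by rewrite size_rcons; apply/allpairsP; exists (v, i); rewrite mem_index_enum.
Qed.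

Lemma words_uniq n : uniq (words n).
Proof.
elim: n => //= n IH; apply: allpairs_uniq => //; first exact: index_enum_uniq.
by move=> [u i] [v j] _ _ /= /rcons_inj[-> ->].
Qed.

Section sums.
Context (R : Type) (idx : R) (op : Monoid.com_law idx).

Lemma big_words0 (F : word -> R) : \big[op/idx]_(v <- words 0) F v = F [::].
Proof. by rewrite big_seq1. Qed.

Lemma big_wordsS n (F : word -> R) :
  \big[op/idx]_(v <- words n.+1) F v =
  \big[op/idx]_(v <- words n) \big[op/idx]_(i : letter hb) F (rcons v i).
Proof. exact: big_allpairs_dep. Qed.

Lemma big_words_cat k n (F : word -> R) :
  \big[op/idx]_(v <- words (k + n)) F v =
  \big[op/idx]_(u <- words k) \big[op/idx]_(v <- words n) F (u ++ v).
Proof.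
elim: n F => [|n IH] F.
  by rewrite addn0; apply: eq_bigr => u _; rewrite big_words0 cats0.
rewrite addnS big_wordsS IH; apply: eq_bigr => u _; rewrite big_wordsS.
by apply: eq_bigr => v _; apply: eq_bigr => i _; rewrite rcons_cat.
Qed.

End sums.
End words.

Section cascade_functionals.
Context (b : nat) (hb : (1 < b)%N) (R : realType).
Notation word := (seq (letter hb)).
Notation env := (environment word R).
Implicit Types (u v : word) (m : word -> R) (e : env).

(** The given weights are nonnegative only almost surely. Absolute values make all masses
    nonnegative in every environment and change nothing almost surely. The index [k.+1] skips the
    root. *)
Definition weight e v : R := \prod_(k < size v) `|e (take k.+1 v)|.

Definition partial_mass n m e := \sum_(v <- words hb n) weight e v * m v.

(* Only nonempty words carry a weight: [reindex (graft u)] is the environment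
   of the subtree at [u], with an unchanged irrelevant value at the root. *)
Definition graft u v := if v == [::] then [::] else u ++ v.

Definition subtree m u v := m (u ++ v).

Definition nonroot : pred word := fun v => v != [::].

Definition up_to n : pred word := fun v => (size v <= n)%N.

Lemma graft_inj u : injective (graft u).
Proof.
move=> v w; rewrite /graft; case: eqP => [->|vn]; case: eqP => [->|wn] //.
- by move/esym; case: (u) => //=; move/wn.
- by case: (u) => //=; move/vn.
- by move/eqP; rewrite eqseq_cat// eqxx /= => /eqP.
Qed.

Lemma weight_nil e : weight e [::] = 1.
Proof. by rewrite /weight big_ord0. Qed.

Lemma weight_rcons e v i : weight e (rcons v i) = weight e v * `|e (rcons v i)|.
Proof.
rewrite /weight size_rcons big_ord_recr /= take_oversize ?size_rcons//.
congr (_ * _); apply: eq_bigr => k _; rewrite -cats1 takel_cat//.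
Qed.

Lemma weight_cat e u v :
  weight e (u ++ v) = weight e u * weight (reindex (graft u) e) v.
Proof.
elim/last_ind: v => [|v i IH]; first by rewrite cats0 weight_nil mulr1.
rewrite -rcons_cat !weight_rcons IH mulrA; congr (_ * `|_|).
by rewrite /reindex /graft; case: eqP => [/(congr1 size)|_]; rewrite ?size_rcons// rcons_cat.
Qed.

Lemma weight_ge0 e v : 0 <= weight e v.
Proof. exact: prodr_ge0. Qed.

Lemma eq_weight e e' v :
  (forall k, (k < size v)%N -> e (take k.+1 v) = e' (take k.+1 v)) ->
  weight e v = weight e' v.
Proof. by move=> ee; apply: eq_bigr => k _; rewrite ee. Qed.

Lemma measurable_weight v : measurable_fun setT (fun e => weight e v).
Proof.
apply: measurable_prod => k _; apply: measurableT_comp => //.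
exact: measurable_coordinate.
Qed.

Lemma partial_mass_ge0 n m e : (forall u, 0 <= m u) -> 0 <= partial_mass n m e.
Proof. by move=> m0; apply: sumr_ge0 => v _; rewrite mulr_ge0// weight_ge0. Qed.

Lemma measurable_partial_mass n m : measurable_fun setT (partial_mass n m).
Proof.
by apply: measurable_sum => v; apply: measurable_funM => //; exact: measurable_weight.
Qed.

Lemma partial_mass0 m e : partial_mass 0 m e = m [::].
Proof. by rewrite /partial_mass big_words0 weight_nil mul1r. Qed.

Lemma partial_massD n k m e : partial_mass (k + n) m e =
  \sum_(u <- words hb k) weight e u * partial_mass n (subtree m u) (reindex (graft u) e).
Proof.
rewrite /partial_mass big_words_cat; apply: eq_bigr => u _.
by rewrite big_distrr /=; apply: eq_bigr => v _; rewrite weight_cat mulrA.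
Qed.

Lemma partial_mass_depends n m : depends_on (up_to n) (partial_mass n m).
Proof.
move=> e e' ee; rewrite /partial_mass !big_seq; apply: eq_bigr => v /size_words vn.
congr (_ * _); apply: eq_weight => k kv; apply: ee.
by rewrite /up_to size_take_min (leq_trans (geq_minr _ _))// vn.
Qed.

Lemma partial_mass_nonroot n m : depends_on nonroot (partial_mass n m).
Proof.
move=> e e' ee; apply: eq_bigr => v _.
congr (_ * _); apply: eq_weight => k kv; apply: ee.
by case: v kv.
Qed.

Lemma weight_depends v : depends_on (up_to (size v)) (fun e => weight e v).
Proof.
move=> e e' ee; apply: eq_weight => k kv; apply: ee.
by rewrite /up_to size_take_min geq_minr.
Qed.

(** A nonempty word grafted at [u] is longer than [u], so the subtree at [u] uses only levels after
    [size u]. *)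
Lemma depends_on_graft T (g : env -> T) u : depends_on nonroot g ->
  depends_on (predC (up_to (size u))) (fun e => g (reindex (graft u) e)).
Proof.
move=> gn e e' ee; apply: gn => v; rewrite /nonroot /reindex /graft => vn.
rewrite (negPf vn); apply: ee; rewrite /= /up_to size_cat -ltnNge -[ltnLHS]addn0.
by rewrite ltn_add2l; case: v vn.
Qed.

Section law.
Variable L : probability env R.
Hypothesis indL : independent_coordinates L.
Hypothesis idL : forall u v (B : set R), nonroot u -> nonroot v -> measurable B ->
  L [set e | B (e u)] = L [set e | B (e v)].
Hypothesis meanL : forall u, nonroot u -> (\int[L]_e `|e u|%:E = 1)%E.

(** As [graft u] fixes the root and keeps other words nonempty, equality of laws is required between
    nonempty words only. *)
Lemma pushforward_graft u A : measurable A ->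
  L (reindex (graft u) @^-1` A) = L A.
Proof.
apply: (pushforward_reindex indL); first exact: graft_inj.
move=> v B mB; rewrite /graft; case: eqP => [->//|/eqP vn].
apply: idL => //; rewrite /nonroot.
by case: (u) vn.
Qed.

Lemma integral_graft u (f : env -> \bar R) : measurable_fun setT f ->
  (forall e, 0 <= f e)%E ->
  (\int[L]_e f (reindex (graft u) e) = \int[L]_e f e)%E.
Proof.
move=> mf f0; transitivity (\int[pushforward L (reindex (graft u))]_e f e)%E.
  by rewrite ge0_integral_pushforward//; exact: measurable_reindex.
apply: eq_measure_integral => [|mS A mA _]; first exact: measurable_reindex.
exact: pushforward_graft.
Qed.

Lemma ae_graft u (Q : env -> Prop) : {ae L, forall e, Q e} ->
  {ae L, forall e, Q (reindex (graft u) e)}.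
Proof.
move=> [N [mN N0 QN]]; exists (reindex (graft u) @^-1` N); split.
- by rewrite -[X in measurable X]setTI; exact: measurable_reindex.
- by rewrite /= pushforward_graft.
- by move=> e nQ; exact: QN.
Qed.

(** [h] and the weight of [u] live on the first [k] levels, while the subtree at [u] lives on later
    ones and has law [L]: each term factors. One-level sums as [g] give the martingale property,
    limit masses as [g] the conditioning of the limit. *)
Lemma branching_integral k (h : env -> R) (g : word -> env -> \bar R) :
  measurable_fun setT h -> (forall e, 0 <= h e) -> depends_on (up_to k) h ->
  (forall u, measurable_fun setT (g u)) -> (forall u e, 0 <= g u e)%E ->
  (forall u, depends_on nonroot (g u)) ->
  (\int[L]_e ((h e)%:E * \sum_(u <- words hb k)
     (weight e u)%:E * g u (reindex (graft u) e)) =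
   \sum_(u <- words hb k) (\int[L]_e (h e * weight e u)%:E) * \int[L]_e g u e)%E.
Proof.
move=> mh h0 hk mg g0 gn.
have mgu u : measurable_fun setT (fun e => g u (reindex (graft u) e)).
  by apply: (measurableT_comp (mg u)); exact: measurable_reindex.
have mhw u : measurable_fun setT (fun e => (h e * weight e u)%:E).
  by apply/measurable_EFinP; apply: measurable_funM => //; exact: measurable_weight.
transitivity (\int[L]_e \sum_(u <- words hb k)
    ((h e * weight e u)%:E * g u (reindex (graft u) e)))%E.
  apply: eq_integral => e _; rewrite ge0_sume_distrr.
    by apply: eq_bigr => u _; rewrite muleA.
  by move=> u _; rewrite mule_ge0// lee_fin weight_ge0.
rewrite ge0_integral_sum//; last 2 first.
- by move=> u; exact: emeasurable_funM.
- by move=> u e _; rewrite mule_ge0// lee_fin mulr_ge0// weight_ge0.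
rewrite !big_seq; apply: eq_bigr => u uk.
rewrite (@independent_integralM _ _ _ indL (up_to k) (fun e => (h e * weight e u)%:E)
  (fun e => g u (reindex (graft u) e)))//.
- by rewrite integral_graft.
- by move=> e; rewrite lee_fin mulr_ge0// weight_ge0.
- move=> e e' ee; rewrite (hk e e')//; congr (_ * _)%:E.
  by apply: weight_depends; rewrite (size_words uk).
- by rewrite -(size_words uk); exact: depends_on_graft.
Qed.

Section tree.
Variable m : word -> R.
Hypotheses (m0 : forall u, 0 <= m u) (m_add : tree_additive m).

Lemma partial_mass_martingale n (h : env -> R) : measurable_fun setT h ->
  (forall e, 0 <= h e) -> depends_on (up_to n) h ->
  (\int[L]_e (h e * partial_mass n.+1 m e)%:E =
   \int[L]_e (h e * partial_mass n m e)%:E)%E.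
Proof.
move=> mh h0 hn.
(* The mass of the one-level cascade below [u]. Its mean is [m u] because the weights have mean 1
   and [m] is additive. *)
pose g u e : \bar R := (\sum_(i : letter hb) `|e [:: i]|%:E * (m (rcons u i))%:E)%E.
have mc v : measurable_fun setT (fun e : env => (`|e v|)%:E).
  by apply/measurable_EFinP; apply: measurableT_comp => //; exact: measurable_coordinate.
have gE u : (\int[L]_e g u e = (m u)%:E)%E.
  rewrite /g ge0_integral_sum//; last 2 first.
  - by move=> i; exact: emeasurable_funM.
  - by move=> i e _; rewrite mule_ge0 ?lee_fin.
  rewrite m_add -sumEFin; apply: eq_bigr => i _.
  by rewrite ge0_integralZr ?lee_fin// meanL// mul1e.
transitivity (\int[L]_e ((h e)%:E * \sum_(u <- words hb n)
     (weight e u)%:E * g u (reindex (graft u) e)))%E.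
  apply: eq_integral => e _; rewrite EFinM; congr (_ * _)%E.
  rewrite /partial_mass big_wordsS -sumEFin; apply: eq_bigr => u _.
  rewrite /g -sumEFin ge0_sume_distrr; last by move=> i _; rewrite mule_ge0 ?lee_fin.
  apply: eq_bigr => i _; rewrite weight_rcons !EFinM muleA /reindex /graft/=.
  by rewrite cats1.
rewrite branching_integral//; first last.
- by move=> u e e' ee; apply: eq_bigr => i _; rewrite ee.
- by move=> u e; apply: sume_ge0 => i _; rewrite mule_ge0 ?lee_fin.
- by move=> u; apply: emeasurable_sum => i; exact: emeasurable_funM.
have mhw u : measurable_fun setT (fun e => (h e * weight e u)%:E).
  by apply/measurable_EFinP; apply: measurable_funM => //; exact: measurable_weight.
under eq_bigr do rewrite gE.
transitivity (\sum_(u <- words hb n) \int[L]_e ((h e * weight e u)%:E * (m u)%:E))%E.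
  apply: eq_bigr => u _; rewrite ge0_integralZr ?lee_fin//.
  by move=> e _; rewrite lee_fin mulr_ge0// weight_ge0.
rewrite -ge0_integral_sum//; last 2 first.
- by move=> u; exact: emeasurable_funM.
- by move=> u e _; rewrite mule_ge0 ?lee_fin// mulr_ge0// weight_ge0.
apply: eq_integral => e _; rewrite /partial_mass big_distrr /= -sumEFin.
by apply: eq_bigr => u _; rewrite mulrA EFinM.
Qed.

Lemma integral_partial_mass n : (\int[L]_e (partial_mass n m e)%:E = (m [::])%:E)%E.
Proof.
elim: n => [|n IH].
  under eq_integral do rewrite partial_mass0.
  by rewrite integral_cst// [X in (_ * X)%E]probability_setT mule1.
rewrite -IH; have := @partial_mass_martingale n (cst 1) (measurable_cst _).
under eq_integral do rewrite mul1r.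
by move=> -> //; under eq_integral do rewrite mul1r.
Qed.

Lemma partial_mass_cvg : {ae L, forall e, cvgn (fun n => partial_mass n m e)}.
Proof.
apply: (@nonnegative_martingale_cvg _ _ _ L (fun n e => partial_mass n m e)).
- by move=> n; exact: measurable_partial_mass.
- by move=> n e; exact: partial_mass_ge0.
- by rewrite integral_partial_mass ltry.
(* A function of the masses up to [n] depends only on the first [n] levels of weights. *)
- move=> n h mh h0 hY; apply: partial_mass_martingale => // e e' ee.
  apply: hY => k kn; apply: partial_mass_depends => v vk; apply: ee.
  exact: leq_trans vk kn.
Qed.

End tree.
End law.
End cascade_functionals.

(** * The limit mass and its expectation *)

Section limit_mass.
Context (b : nat) (hb : (1 < b)%N) (R : realType).
Notation word := (seq (letter hb)).
Notation env := (environment word R).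
Implicit Types (u v : word) (m : word -> R) (e : env).

(** A lower limit is defined and measurable everywhere; almost surely it is a limit. *)
Definition limit_mass m e : \bar R := limn_einf (fun n => (partial_mass n m e)%:E).

(** Convergence is required in all subtrees at once, a countable family, so that the limit can be
    split at any level on one event of full measure. *)
Definition convergent_masses m e := forall u,
  cvgn (fun n => partial_mass n (subtree m u) (reindex (graft u) e)).

Lemma subtree_nil m : subtree m [::] = m.
Proof. by apply/funext. Qed.

Lemma subtree_cat m u v : subtree (subtree m u) v = subtree m (u ++ v).
Proof. by apply/funext => w; rewrite /subtree catA. Qed.

Lemma subtree_additive m u : tree_additive m -> tree_additive (subtree m u).
Proof. by move=> ma v; rewrite /subtree ma; apply: eq_bigr => i _; rewrite rcons_cat. Qed.

Lemma reindex_graft_nil e : reindex (graft [::]) e = e.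
Proof. by apply/funext => v; rewrite /reindex /graft; case: eqP => // ->. Qed.

Lemma limit_mass_cvg m e : cvgn (fun n => partial_mass n m e) ->
  limit_mass m e = (limn (fun n => partial_mass n m e))%:E.
Proof.
move=> cm; have : (partial_mass n m e)%:E @[n --> \oo] -->
    (limn (fun n => partial_mass n m e))%:E by apply/cvg_EFin => //; exact: nearW.
by move=> /cvg_limn_einf_sup[].
Qed.

Lemma limit_mass_ge0 m e : (forall u, 0 <= m u) -> (0 <= limit_mass m e)%E.
Proof.
move=> m0; apply: (@limn_einf_ge _ _ _ 0%N) => n _.
by rewrite lee_fin partial_mass_ge0.
Qed.

Lemma measurable_limit_mass m : measurable_fun setT (limit_mass m).
Proof.
apply: measurable_limn_einf => n; apply/measurable_EFinP.
exact: measurable_partial_mass.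
Qed.

Lemma limit_mass_nonroot m : depends_on (@nonroot b hb) (limit_mass m).
Proof.
move=> e e' ee; congr limn_einf; apply/funext => n; congr EFin.
exact: partial_mass_nonroot.
Qed.

(** With [k] fixed, [partial_massD] is a finite sum, so the limit passes through it. *)
Lemma cvg_partial_mass_split m e k : convergent_masses m e ->
  partial_mass n m e @[n --> \oo] --> \sum_(u <- words hb k) weight e u *
    limn (fun n => partial_mass n (subtree m u) (reindex (graft u) e)).
Proof.
move=> cm; rewrite -(@cvg_shiftn k).
under eq_fun do rewrite addnC partial_massD.
apply: cvg_big => [|u _]; [exact: add_continuous|apply: cvgMr; exact: cm].
Qed.

Lemma limit_mass_split m e k : convergent_masses m e ->
  (limit_mass m e = \sum_(u <- words hb k) (weight e u)%:E *
    limit_mass (subtree m u) (reindex (graft u) e))%E.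
Proof.
move=> cm; have cmk := cvg_partial_mass_split (k := k) cm.
rewrite limit_mass_cvg; last by apply/cvg_ex; eexists; exact: cmk.
move/cvg_lim : cmk => ->//; rewrite -sumEFin; apply: eq_bigr => u _.
by rewrite limit_mass_cvg// EFinM.
Qed.

Section law.
Variable L : probability env R.
Hypothesis indL : independent_coordinates L.
Hypothesis idL : forall u v (B : set R), nonroot u -> nonroot v -> measurable B ->
  L [set e | B (e u)] = L [set e | B (e v)].
Hypothesis meanL : forall u, nonroot u -> (\int[L]_e `|e u|%:E = 1)%E.

Definition expected_mass m : \bar R := (\int[L]_e limit_mass m e)%E.

Section tree.
Variable m : word -> R.
Hypotheses (m0 : forall u, 0 <= m u) (m_add : tree_additive m).

Lemma ae_convergent_masses : {ae L, forall e, convergent_masses m e}.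
Proof.
apply: ae_forall_countable => u.
apply: (@ae_graft b hb R L indL idL u
  (fun e => cvgn (fun n => partial_mass n (subtree m u) e))).
apply: partial_mass_cvg => // [v|]; first exact: m0.
exact: subtree_additive.
Qed.

Lemma expected_mass_ge0 : (0 <= expected_mass m)%E.
Proof. by apply: integral_ge0 => e _; exact: limit_mass_ge0. Qed.

(** Fatou's lemma. Equality may fail: the martingale can lose mass in the limit. *)
Lemma expected_mass_le : (expected_mass m <= (m [::])%:E)%E.
Proof.
apply: (@le_trans _ _ (limn_einf (fun n => \int[L]_e (partial_mass n m e)%:E)%E)).
  apply: fatou => //.
  - by move=> n; apply/measurable_EFinP; exact: measurable_partial_mass.
  - by move=> n e _; rewrite lee_fin partial_mass_ge0.
by apply: limn_einf_le => n; rewrite integral_partial_mass.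
Qed.

Lemma expected_mass_fin : expected_mass m \is a fin_num.
Proof.
rewrite ge0_fin_numE ?expected_mass_ge0//.
exact: le_lt_trans expected_mass_le (ltry _).
Qed.

Lemma integral_limit_mass_split k (h : env -> R) : measurable_fun setT h ->
  (forall e, 0 <= h e) -> depends_on (up_to k) h ->
  (\int[L]_e ((h e)%:E * limit_mass m e) = \sum_(u <- words hb k)
    (\int[L]_e (h e * weight e u)%:E) * expected_mass (subtree m u))%E.
Proof.
move=> mh h0 hk; rewrite -branching_integral//; first last.
- by move=> u; exact: limit_mass_nonroot.
- by move=> u e; apply: limit_mass_ge0 => v; exact: m0.
- by move=> u; exact: measurable_limit_mass.
apply: ge0_ae_eq_integral => //.
- by apply: emeasurable_funM; [exact/measurable_EFinP|exact: measurable_limit_mass].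
- apply: emeasurable_funM; first exact/measurable_EFinP.
  apply: emeasurable_sum => u; apply: emeasurable_funM.
    by apply/measurable_EFinP; exact: measurable_weight.
  apply: (measurableT_comp (measurable_limit_mass _)).
  exact: measurable_reindex.
- by move=> e _; rewrite mule_ge0 ?lee_fin ?limit_mass_ge0.
- move=> e _; rewrite mule_ge0 ?lee_fin// sume_ge0// => u _.
  rewrite mule_ge0 ?lee_fin ?weight_ge0// limit_mass_ge0// => v; exact: m0.
apply: filterS ae_convergent_masses => e cm _ /=.
by rewrite (limit_mass_split k cm).
Qed.

Lemma expected_mass_split :
  (expected_mass m = \sum_(i : letter hb) expected_mass (subtree m [:: i]))%E.
Proof.
have := @integral_limit_mass_split 1 (cst 1) (measurable_cst _).
under eq_integral do rewrite mul1e.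
move=> H; rewrite {1}/expected_mass H//.
rewrite big_wordsS big_words0; apply: eq_bigr => i _ /=.
under eq_integral do rewrite mul1r -[[:: i]]/(rcons [::] i) weight_rcons weight_nil mul1r.
by rewrite meanL// mul1e.
Qed.

End tree.

(** A lower limit is only superadditive. Almost sure convergence of each martingale turns it into a
    limit, which is additive. *)
Lemma expected_mass_sum (I : finType) (f : I -> word -> R) :
  (forall i u, 0 <= f i u) -> (forall i, tree_additive (f i)) ->
  (\sum_i expected_mass (f i) = expected_mass (fun u => \sum_i f i u)%R)%E.
Proof.
move=> f0 fa; rewrite /expected_mass -ge0_integral_sum//; last 2 first.
- by move=> i; exact: measurable_limit_mass.
- by move=> i e _; exact: limit_mass_ge0.
apply: ge0_ae_eq_integral => //.
- by apply: emeasurable_sum => i; exact: measurable_limit_mass.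
- exact: measurable_limit_mass.
- by move=> e _; apply: sume_ge0 => i _; exact: limit_mass_ge0.
- by move=> e _; apply: limit_mass_ge0 => u; exact: sumr_ge0.
have : {ae L, forall e, forall i, cvgn (fun n => partial_mass n (f i) e)}.
  apply: ae_forall_countable => i.
  exact: (partial_mass_cvg indL idL meanL (f0 i) (fa i)).
apply: filterS => e ce _.
have cs : partial_mass n (fun u => \sum_i f i u) e @[n --> \oo] -->
    \sum_i limn (fun n => partial_mass n (f i) e).
  rewrite (_ : (fun n => _) = fun n => \sum_i partial_mass n (f i) e); last first.
    apply/funext => n; rewrite /partial_mass exchange_big/=; apply: eq_bigr => u _.
    by rewrite big_distrr.
  by apply: cvg_big => [|i _]; [exact: add_continuous|exact: ce].
rewrite limit_mass_cvg; last by apply/cvg_ex; eexists; exact: cs.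
move/cvg_lim : cs => ->//; rewrite -sumEFin; apply: eq_bigr => i _.
by rewrite limit_mass_cvg.
Qed.

Section invariant_measure.
Variable nu : probability (Sigma hb) R.
Hypotheses (nu_inv : shift_invariant nu) (nu_erg : shift_ergodic nu).

Definition cylinder_mass u : R := fine (nu (word_cylinder u)).

Lemma cylinder_massE u : (cylinder_mass u)%:E = nu (word_cylinder u).
Proof. by rewrite fineK// fin_num_measure//; exact: measurable_word_cylinder. Qed.

Lemma cylinder_mass_ge0 u : 0 <= cylinder_mass u.
Proof. by rewrite fine_ge0. Qed.

Lemma cylinder_mass_additive : tree_additive cylinder_mass.
Proof. exact: tree_additive_measure. Qed.

Lemma cylinder_mass_shift u :
  \sum_(i : letter hb) cylinder_mass (i :: u) = cylinder_mass u.
Proof.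
apply: EFin_inj; rewrite -sumEFin cylinder_massE.
rewrite -(nu_inv (measurable_word_cylinder u)) measure_preimage_left_shift.
by apply: eq_bigr => i _; rewrite cylinder_massE.
Qed.

Lemma expected_cylinder_mass u :
  expected_mass (subtree cylinder_mass u) =
  (expected_mass cylinder_mass * (cylinder_mass u)%:E)%E.
Proof.
have s0 v w : 0 <= subtree cylinder_mass v w by exact: cylinder_mass_ge0.
have sa v : tree_additive (subtree cylinder_mass v).
  by apply: subtree_additive; exact: cylinder_mass_additive.
(* The values of E(Q.nu) on cylinders. *)
pose p v := fine (expected_mass (subtree cylinder_mass v)).
have pE v : (p v)%:E = expected_mass (subtree cylinder_mass v).
  by rewrite fineK// expected_mass_fin.
have p0 v : 0 <= p v by rewrite fine_ge0// expected_mass_ge0.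
have pa : tree_additive p.
  move=> v; apply: EFin_inj; rewrite -sumEFin pE expected_mass_split//.
  by apply: eq_bigr => i _; rewrite pE subtree_cat cats1.
have ple v : p v <= cylinder_mass v.
  rewrite -lee_fin pE (le_trans (expected_mass_le _ _))// /subtree cats0//.
have [mu muE] := tree_measure_exists p0 pa.
(* The measure [nu] - E(Q.nu): the bound [ple] holds on cylinders, and additivity of the difference
   extends it to Borel sets, as [nu] = [mu] + [mu']. *)
have [mu' mu'E] : exists mu' : {finite_measure set (Sigma hb) -> \bar R},
    forall v, mu' (word_cylinder v) = (cylinder_mass v - p v)%:E.
  apply: tree_measure_exists => v; first by rewrite subr_ge0.
  by rewrite cylinder_mass_additive pa sumrB.
have nuE A : measurable A -> nu A = (mu A + mu' A)%E.
  move=> mA; rewrite -measure_addE.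
  apply: (@Sigma_measure_unique b hb R nu (measure_add mu mu')) => //.
    move=> v; apply: etrans (esym (measure_addE mu mu' _)).
    have mid : (cylinder_mass v)%:E = ((p v)%:E + (cylinder_mass v - p v)%:E)%E.
      by rewrite -EFinD addrC subrK.
    exact: etrans (esym (cylinder_massE v))
      (etrans mid (esym (congr2 _ (muE v) (mu'E v)))).
  exact: le_lt_trans (probability_le1 nu measurableT) (ltry 1).
(* Summing over the first letter commutes with [expected_mass], and invariance of [nu] gives back
   the masses below [v]. *)
have mu_shift v : mu (@left_shift b hb @^-1` word_cylinder v) = (p v)%:E.
  rewrite measure_preimage_left_shift.
  rewrite (eq_bigr (fun i => expected_mass (subtree cylinder_mass (i :: v)))).
    rewrite expected_mass_sum// pE; congr expected_mass; apply/funext => w.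
    by rewrite /subtree cylinder_mass_shift.
  by move=> i _; rewrite -pE; exact: muE.
have muT : mu setT = (p [::])%:E by rewrite -muE word_cylinder_nil.
have mu_inv A : measurable A -> mu (@left_shift b hb @^-1` A) = mu A.
  pose m' : {measure set (Sigma hb) -> \bar R} := pushforward mu (@left_shift b hb).
  move=> mA; apply/esym.
  apply: (@Sigma_measure_unique b hb R mu (m' (@measurable_left_shift b hb))) => //.
    by move=> v; exact: etrans (muE v) (esym (mu_shift v)).
  by apply: le_lt_trans (ltry (p [::])); rewrite -muT.
have mu_nu A : measurable A -> nu A = 0%E -> mu A = 0%E.
  by move=> mA; rewrite nuE// => /eqP; rewrite padde_eq0// => /andP[/eqP].
have muA := @ergodic_dominated_measureE _ _ R nu mu (@left_shift b hb)
  (@measurable_left_shift b hb) nu_inv mu_inv nu_erg mu_nu _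
  (measurable_word_cylinder u).
transitivity (mu (word_cylinder u)); first by rewrite -pE; exact/esym/muE.
apply: etrans muA _; congr (_ * _)%E; last exact/esym/cylinder_massE.
by apply: etrans muT _; rewrite pE subtree_nil.
Qed.

End invariant_measure.
End law.
End limit_mass.

(** * The alternative for the limit mass *)

Section dichotomy.
Context (b : nat) (hb : (1 < b)%N) (R : realType).
Notation word := (seq (letter hb)).
Notation env := (environment word R).
Variable L : probability env R.
Hypothesis indL : independent_coordinates L.
Hypothesis idL : forall (u v : word) (B : set R), nonroot u -> nonroot v ->
  measurable B -> L [set e | B (e u)] = L [set e | B (e v)].
Hypothesis meanL : forall u : word, nonroot u -> (\int[L]_e `|e u|%:E = 1)%E.
Variable nu : probability (Sigma hb) R.
Hypotheses (nu_inv : shift_invariant nu) (nu_erg : shift_ergodic nu).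

Let N := cylinder_mass nu.
Let Z := limit_mass N.
Let S n e := partial_mass n N e.
(** Real-valued version of [Z]; an infinite value becomes 0, on a null set only. *)
Let z e := fine (Z e).

Let N0 : forall u, 0 <= N u := cylinder_mass_ge0 nu.
Let Nadd : tree_additive N := cylinder_mass_additive nu.

Let S0 n e : 0 <= S n e. Proof. exact: partial_mass_ge0. Qed.
Let Z0 e : (0 <= Z e)%E. Proof. exact: limit_mass_ge0. Qed.
Let z0 e : 0 <= z e. Proof. exact: fine_ge0. Qed.
Let mS n : measurable_fun setT (S n). Proof. exact: measurable_partial_mass. Qed.
Let mZ : measurable_fun setT Z. Proof. exact: measurable_limit_mass. Qed.
Let mz : measurable_fun setT z. Proof. exact: measurableT_comp. Qed.

Lemma limit_mass_test n (h : env -> R) : measurable_fun setT h ->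
  (forall e, 0 <= h e) -> depends_on (@up_to b hb n) h ->
  (\int[L]_e ((h e)%:E * Z e) =
   expected_mass L N * \int[L]_e (h e * S n e)%:E)%E.
Proof.
move=> mh h0 hn; rewrite /Z (integral_limit_mass_split indL idL meanL N0 Nadd mh h0 hn).
have mhw u : measurable_fun setT (fun e => (h e * weight e u)%:E).
  by apply/measurable_EFinP; apply: measurable_funM => //; exact: measurable_weight.
have hw0 u e : (0 <= (h e * weight e u)%:E)%E by rewrite lee_fin mulr_ge0// weight_ge0.
transitivity (\sum_(u <- words hb n) expected_mass L N *
    \int[L]_e ((h e * weight e u)%:E * (N u)%:E))%E.
  apply: eq_bigr => u _; rewrite (expected_cylinder_mass indL idL meanL nu_inv nu_erg).
  by rewrite ge0_integralZr ?lee_fin// muleCA.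
rewrite -ge0_sume_distrr; last first.
  by move=> u _; apply: integral_ge0 => e _; apply: mule_ge0 => //; rewrite lee_fin.
congr (_ * _)%E; rewrite -ge0_integral_sum//; last 2 first.
- by move=> u; exact: emeasurable_funM.
- by move=> u e _; apply: mule_ge0 => //; rewrite lee_fin.
apply: eq_integral => e _; rewrite /S /partial_mass big_distrr/= -sumEFin.
by apply: eq_bigr => u _; rewrite mulrA EFinM.
Qed.

Let ae_cvg : {ae L, forall e, Z e = (z e)%:E /\ S n e @[n --> \oo] --> z e}.
Proof.
apply: filterS (partial_mass_cvg indL idL meanL N0 Nadd) => e ce.
by rewrite /z /Z limit_mass_cvg//.
Qed.

Let integrable_z : L.-integrable setT (EFin \o z).
Proof.
apply/integrableP; split; first exact/measurable_EFinP.
apply: (@le_lt_trans _ _ (\int[L]_e Z e)%E).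
  apply: ge0_le_integral => //.
  - by apply: measurableT_comp => //; exact/measurable_EFinP.
  - move=> e _; rewrite /= ger0_norm// /z.
    by case: (Z e) (Z0 e) => [r _|_|//] /=; rewrite ?lexx ?leey.
exact: le_lt_trans (expected_mass_le indL idL meanL N0 Nadd) (ltry _).
Qed.

Let psi e := z e / (1 + z e).

Let pos1 (x : R) : 0 <= x -> 0 < 1 + x. Proof. lra. Qed.

Let minv (g : env -> R) : measurable_fun setT g -> (forall e, 0 <= g e) ->
  measurable_fun setT (fun e => (1 + g e)^-1).
Proof.
move=> mg g0; rewrite (_ : (fun e => _) = (fun e => powR (1 + g e) (-1))).
  apply: (measurableT_comp (measurable_powR (-1)%R)); exact: measurable_funD.
by apply/funext => e; rewrite powR_inv1// ltW// pos1.
Qed.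

Let mdiv (f g : env -> R) : measurable_fun setT f -> measurable_fun setT g ->
  (forall e, 0 <= g e) -> measurable_fun setT (fun e => f e / (1 + g e)).
Proof. by move=> mf mg g0; apply: measurable_funM => //; exact: minv. Qed.

Let cvg_div (f g : nat -> R) (x y : R) : 0 <= y -> f n @[n --> \oo] --> x ->
  g n @[n --> \oo] --> y -> (f n / (1 + g n))%:E @[n --> \oo] --> (x / (1 + y))%:E.
Proof.
move=> y0 fx gy; apply/cvg_EFin; first exact: nearW.
apply: cvgM => //; apply: cvgV; first by rewrite gt_eqF// pos1.
by apply: cvgD => //; exact: cvg_cst.
Qed.

Lemma expected_mass_dichotomy :
  expected_mass L N = 1%E \/ {ae L, forall e, Z e = 0%E}.
Proof.
have Ifin : expected_mass L N \is a fin_num.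
  exact: (expected_mass_fin indL idL meanL N0 Nadd).
have H n : (\int[L]_e (z e / (1 + S n e))%:E =
            expected_mass L N * \int[L]_e (S n e / (1 + S n e))%:E)%E.
  under [in RHS]eq_integral do rewrite mulrC.
  rewrite -limit_mass_test.
  - apply: ge0_ae_eq_integral => //.
    + by apply/measurable_EFinP; exact: mdiv.
    + apply: emeasurable_funM => //; apply/measurable_EFinP.
      exact: minv.
    + by move=> e _; rewrite lee_fin divr_ge0// ltW// pos1.
    + by move=> e _; rewrite mule_ge0// lee_fin invr_ge0 ltW// pos1.
    + by apply: filterS ae_cvg => e [-> _] _; rewrite mulrC EFinM.
  - exact: minv.
  - by move=> e; rewrite invr_ge0 ltW// pos1.
  - by move=> e e' ee; congr (_ + _)^-1; exact: partial_mass_depends ee.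
(* Dominated by [z], which is integrable by Fatou's lemma. *)
have l1 : (\int[L]_e (z e / (1 + S n e))%:E @[n --> \oo] --> \int[L]_e (psi e)%:E)%E.
  have [] := @dominated_convergence _ _ R L setT measurableT
    (fun n e => (z e / (1 + S n e))%:E) (EFin \o psi) (EFin \o z) => //.
  - by move=> n; apply/measurable_EFinP; exact: mdiv.
  - by apply/measurable_EFinP; exact: mdiv.
  - apply: filterS ae_cvg => e [_ cS] _; apply: cvg_div => //; exact: cvg_cst.
  - apply: aeW => e n _; rewrite /= lee_fin ger0_norm ?divr_ge0 ?(ltW (pos1 _))//.
    by rewrite ler_pdivrMr ?pos1// ler_peMr// lerDl.
(* Dominated by 1, thanks to the choice of the test function. *)
have l2 : (\int[L]_e (S n e / (1 + S n e))%:E @[n --> \oo] --> \int[L]_e (psi e)%:E)%E.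
  have [] := @dominated_convergence _ _ R L setT measurableT
    (fun n e => (S n e / (1 + S n e))%:E) (EFin \o psi) (cst 1%E) => //.
  - by move=> n; apply/measurable_EFinP; exact: mdiv.
  - by apply/measurable_EFinP; exact: mdiv.
  - by apply: filterS ae_cvg => e [_ cS] _; apply: cvg_div.
  - exact: finite_measure_integrable_cst.
  - apply: aeW => e n _; rewrite /= lee_fin ger0_norm ?divr_ge0 ?(ltW (pos1 _))//.
    by rewrite ler_pdivrMr ?pos1// mul1r lerDr.
have psi0 e : 0 <= psi e by rewrite divr_ge0// ltW// pos1.
have psi_fin : (\int[L]_e (psi e)%:E)%E \is a fin_num.
  rewrite ge0_fin_numE; last by apply: integral_ge0 => e _; rewrite lee_fin.
  apply: (@le_lt_trans _ _ (\int[L]_e `|(z e)%:E|)%E).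
    apply: ge0_le_integral => //.
    - by move=> e _; rewrite lee_fin.
    - by apply/measurable_EFinP; exact: mdiv.
    - by apply: measurableT_comp => //; exact/measurable_EFinP.
    - move=> e _; rewrite /= lee_fin ger0_norm// ler_pdivrMr ?pos1// ler_peMr//.
      by rewrite lerDl.
  by have /integrableP[] := integrable_z.
have psiE : (\int[L]_e (psi e)%:E = expected_mass L N * \int[L]_e (psi e)%:E)%E.
  have l3 := cvgeZl Ifin l2.
  rewrite (_ : (fun n => _) = fun n => \int[L]_e (z e / (1 + S n e))%:E)%E in l3.
    by rewrite -{1}(cvg_lim _ l1)// -(cvg_lim _ l3).
  by apply/funext => n; rewrite H.
have [->|c1] := eqVneq (expected_mass L N) 1%E; [by left|right].
(* The finite expectation of [psi] is fixed under multiplication by a constant other than 1, hence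
   zero; and [psi] vanishes only where [z] does. *)
have : (\int[L]_e `|(psi e)%:E| = 0)%E.
  under eq_integral do rewrite gee0_abs ?lee_fin//.
  move: psiE c1; rewrite -(fineK psi_fin) -(fineK Ifin) -EFinM => -[].
  set p := fine _; set c := fine _ => pE.
  rewrite eqe => c1; have /eqP : (1 - c) * p = 0 by rewrite mulrBl mul1r -pE subrr.
  by rewrite mulf_eq0 subr_eq0 eq_sym (negPf c1)/= => /eqP ->.
move/(ae_eq_integral_abs L measurableT _).1.
have mpsi : measurable_fun setT (fun e => (psi e)%:E).
  by apply/measurable_EFinP; exact: mdiv.
move=> /(_ mpsi) psi_ae.
apply: filterS2 ae_cvg psi_ae => e [-> _] /(_ I)[/eqP].
by rewrite mulf_eq0 invr_eq0 (gt_eqF (pos1 (z0 e))) orbF => /eqP ->.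
Qed.

End dichotomy.

(** * The limit measure *)

Section integral_complements.
Context d (T : measurableType d) (R : realType) (mu : {measure set T -> \bar R}).
Local Open Scope ereal_scope.

(** The integral of a nonnegative function is a supremum over the simple functions below it, and
    this is monotone for arbitrary functions. *)
Lemma ge0_le_integral_nonmeasurable (f g : T -> \bar R) :
  (forall x, 0 <= f x) -> (forall x, f x <= g x) ->
  \int[mu]_x f x <= \int[mu]_x g x.
Proof.
move=> f0 fg; rewrite !ge0_integralTE// => [|x]; last exact: le_trans (fg x).
apply: le_ereal_sup => _ [h hf <-]; exists h => // x.
exact: le_trans (hf x) (fg x).
Qed.

(* [f] need not be measurable: this is for [cascade_measure w setT], whose
   measurability in [w] is unclear on the null event without a limit. *)
Lemma ge0_ae_eq_integral_nonmeasurable (f g : T -> \bar R) :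
  measurable_fun setT g -> (forall x, 0 <= f x) -> (forall x, 0 <= g x) ->
  {ae mu, forall x, f x = g x} -> \int[mu]_x f x = \int[mu]_x g x.
Proof.
move=> mg f0 g0 [N [mN N0 fgN]].
(* [g1] and [g2] are measurable, agree with [g] off the null set [N], and bracket [f] on [N] between
   0 and infinity. *)
pose g1 x := if x \in N then 0 else g x.
pose g2 x := if x \in N then +oo else g x.
have mN' : measurable_fun setT (fun x => x \in N).
  apply: (@measurable_fun_bool _ _ _ _ true).
  rewrite setTI (_ : _ @^-1` _ = N)//.
  by apply/seteqP; split=> x /= => [/set_mem|/mem_set].
have mg1 : measurable_fun setT g1 by exact: measurable_fun_ifT.
have mg2 : measurable_fun setT g2 by exact: measurable_fun_ifT.
have ae1 : {ae mu, forall x, setT x -> g1 x = g x}.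
  exists N; split=> // x /= H; apply: contrapT => xN; apply: H => _.
  by rewrite /g1 memNset.
have ae2 : {ae mu, forall x, setT x -> g2 x = g x}.
  exists N; split=> // x /= H; apply: contrapT => xN; apply: H => _.
  by rewrite /g2 memNset.
have fg x : x \notin N -> f x = g x.
  move=> xN; apply: contrapT => H; move/negP: xN; apply.
  by rewrite inE; exact: fgN.
have g10 x : 0 <= g1 x by rewrite /g1; case: ifP.
have g20 x : 0 <= g2 x by rewrite /g2; case: ifP.
apply/eqP; rewrite eq_le; apply/andP; split.
  rewrite -(@ge0_ae_eq_integral _ _ _ mu setT g2 g)//.
  apply: ge0_le_integral_nonmeasurable => // x.
  by rewrite /g2; case: ifPn => [|/fg ->//]; rewrite leey.
rewrite -(@ge0_ae_eq_integral _ _ _ mu setT g1 g)//.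
apply: ge0_le_integral_nonmeasurable => // x.
by rewrite /g1; case: ifPn => [|/fg ->].
Qed.

Lemma density_measure_exists (f : T -> \bar R) : measurable_fun setT f ->
  (forall x, 0 <= f x) -> \int[mu]_x f x < +oo ->
  exists m : {finite_measure set T -> \bar R},
    m = (fun A => \int[mu]_(x in A) f x) :> (set T -> \bar R).
Proof.
move=> mf f0 foo; pose m A := \int[mu]_(x in A) f x.
have m0 : m set0 = 0 by exact: integral_set0.
have mge0 A : 0 <= m A by exact: integral_ge0.
have msig : semi_sigma_additive m.
  move=> F mF tF mUF; rewrite /m ge0_integral_bigcup//; last exact: measurable_funTS.
  by apply: is_cvg_ereal_nneg_natsum => n _; exact: integral_ge0.
pose mm := isMeasure.Build _ _ _ m m0 mge0 msig.
pose m1 : {measure set T -> \bar R} := HB.pack m mm.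
have fm : fin_num_fun m1 by exact: lty_fin_num_fun.
pose fm' := Measure_isFinite.Build _ _ _ m1 fm.
pose m2 : {finite_measure set T -> \bar R} :=
  HB.pack (Measure.sort m1) (Measure.class m1) fm'.
by exists m2.
Qed.

End integral_complements.

(** * Weak convergence from convergence on cylinders *)

Section weak_convergence.
Context (b : nat) (hb : (1 < b)%N) (R : realType).
Notation word := (seq (letter hb)).

Lemma continuous_measurable_Sigma (f : Sigma hb -> R) : continuous f ->
  measurable_fun setT f.
Proof.
move=> cf; apply: (measurability _ (RGenOpens.measurableE R)).
move=> _ [_ [x [y ->]] <-]; rewrite setTI; apply: sub_sigma_algebra.
by apply: open_comp => [? _|]; [exact: cf|exact: interval_open].
Qed.

Definition sample (u : word) : Sigma hb := fun n => nth point u n.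

Lemma initial_word_sample u : initial_word (sample u) (size u) = u.
Proof. exact: mkseq_nth. Qed.

Section step.
Variables (m : {finite_measure set (Sigma hb) -> \bar R}) (f : Sigma hb -> R).
Hypotheses (cf : continuous f) (bf : bounded_fun f).

Let integrable_bounded (g : Sigma hb -> R) : measurable_fun setT g ->
  bounded_fun g -> m.-integrable setT (EFin \o g).
Proof.
move=> mg bg; apply: measurable_bounded_integrable => //.
exact: fin_num_fun_lty.
Qed.

Lemma integrable_continuous : m.-integrable setT (EFin \o f).
Proof. by apply: integrable_bounded => //; exact: continuous_measurable_Sigma. Qed.

Lemma step_funE k x : f (sample (initial_word x k)) =
  \sum_(v <- words hb k) f (sample v) * \1_(word_cylinder v) x.
Proof.
rewrite (bigD1_seq (initial_word x k))/=; last 2 first.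
- by have := mem_words (initial_word x k); rewrite size_initial_word.
- exact: words_uniq.
rewrite indicE mem_set ?mulr1; last exact: initial_word_cylinder.
rewrite big_seq_cond big1 ?addr0// => v /andP[/size_words vk vx].
rewrite indicE memNset ?mulr0// /word_cylinder /= vk => xv.
by move/eqP: vx; rewrite xv.
Qed.

(** The sum is the integral of the step function that takes, on each cylinder of length [k], the
    value of [f] at its sample point; it is uniformly within [e] of [f]. *)
Lemma step_integral (e : R) k :
  (forall x y, initial_word x k = initial_word y k -> `|f x - f y| < e) ->
  `|\int[m]_x f x - \sum_(v <- words hb k) f (sample v) * fine (m (word_cylinder v))|
  <= e * fine (m setT).
Proof.
move=> fe; pose g x := f (sample (initial_word x k)).
have ind v : m.-integrable setT (EFin \o (\1_(word_cylinder v) : Sigma hb -> R)).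
  apply: integrable_bounded; first by apply: measurable_indic; exact: measurable_word_cylinder.
  exists 1; split => // M M1 x _; apply: le_trans (ltW M1).
  by rewrite /= indicE ger0_norm// lern1 leq_b1.
pose h v x : R := f (sample v) * \1_(word_cylinder v) x.
have indZ v : m.-integrable setT (EFin \o h v).
  rewrite (_ : _ \o _ = fun x => ((f (sample v))%:E * (\1_(word_cylinder v) x)%:E)%E).
    exact: (integrableZl measurableT (f (sample v)) (ind v)).
  by apply/funext => x; rewrite /= EFinM.
have gE x : (g x)%:E = (\sum_(v <- words hb k) (h v x)%:E)%E.
  by rewrite /g step_funE sumEFin.
have intg : m.-integrable setT (EFin \o g).
  rewrite (_ : EFin \o g = fun x => (\sum_(v <- words hb k) (h v x)%:E)%E).
    by apply: integrable_sum => // v _; exact: indZ.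
  by apply/funext => x; rewrite -gE.
have -> : \sum_(v <- words hb k) f (sample v) * fine (m (word_cylinder v)) =
    \int[m]_x g x.
  rewrite /Rintegral; under eq_integral do rewrite gE.
  rewrite (integral_sum measurableT indZ) -sum_fine; last first.
    by move=> v _; exact: integrable_fin_num.
  apply: eq_bigr => v _; rewrite -[RHS]/(\int[m]_x (f (sample v) * \1_(word_cylinder v) x)).
  rewrite RintegralZl// /Rintegral integral_indic ?setIT//.
  exact: measurable_word_cylinder.
rewrite -RintegralB//; last exact: integrable_continuous.
have intfg : m.-integrable setT (EFin \o (fun x => f x - g x)).
  rewrite (_ : _ \o _ = ((EFin \o f) \- (EFin \o g))%E)//.
  by apply: integrableB => //; exact: integrable_continuous.
apply: le_trans (le_normr_Rintegral _ intfg) _ => //.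
rewrite -Rintegral_cst//; apply: le_Rintegral => //.
- exact: integrable_norm.
- exact: finite_measure_integrable_cst.
move=> x _; apply/ltW/fe.
by have := initial_word_sample (initial_word x k); rewrite size_initial_word.
Qed.

End step.

Lemma weak_cvg_word_cylinders (m_ : nat -> {finite_measure set (Sigma hb) -> \bar R})
    (m : {finite_measure set (Sigma hb) -> \bar R}) :
  (forall u, m_ n (word_cylinder u) @[n --> \oo] --> m (word_cylinder u)) ->
  weak_cvg (fun n => m_ n) m.
Proof.
move=> cm f cf bf.
have fin (mu : {finite_measure set (Sigma hb) -> \bar R}) :
    (\int[mu]_x (f x)%:E)%E \is a fin_num.
  by apply: integrable_fin_num => //; exact: integrable_continuous.
rewrite -(fineK (fin m)); apply/cvg_EFin; first by apply: nearW => n; exact: fin.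
have cmR u : fine (m_ n (word_cylinder u)) @[n --> \oo] --> fine (m (word_cylinder u)).
  apply: fine_cvg; rewrite fineK; first exact: cm.
  by apply: fin_num_measure; exact: measurable_word_cylinder.
set t := fine (m setT).
have t0 : 0 <= t by exact: fine_ge0.
apply/cvgrPdist_lt => eta eta0.
(* The errors are [e * t] for the step approximation under [m], at most [e * (t + 1)] under [m_ n],
   whose mass is eventually below [t + 1], and [e] between the two sums. *)
pose e := eta / (2 * t + 2).
have e0 : 0 < e by rewrite divr_gt0//; lra.
have [k fk] := continuous_uniform_words cf e0.
pose G (mu : set (Sigma hb) -> \bar R) :=
  \sum_(v <- words hb k) f (sample v) * fine (mu (word_cylinder v)).
have cG : G (m_ n) @[n --> \oo] --> G m.
  by apply: cvg_big => [|v _]; [exact: add_continuous|apply: cvgMr; exact: cmR].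
have ct : fine (m_ n setT) @[n --> \oo] --> t.
  by rewrite /t -(word_cylinder_nil hb); exact: cmR.
have /cvgrPdist_lt/(_ _ e0) nG := cG.
have /cvgrPdist_lt/(_ _ ltr01) nt := ct.
near=> n.
have Gn : `|G m - G (m_ n)| < e by near: n.
have tn : `|t - fine (m_ n setT)| < 1 by near: n.
have := step_integral m cf bf fk; have := step_integral (m_ n) cf bf fk.
rewrite -/(G m) -/(G (m_ n)) -/t /Rintegral /=.
move=> h1 h2.
have : e * fine (m_ n setT) <= e * (t + 1).
  by rewrite ler_pM2l//; move: tn; rewrite ltr_norml => /andP[]; lra.
have eE : e * (2 * t + 2) = eta by rewrite /e divfK// gt_eqF//; lra.
move: h1 h2 Gn; rewrite !ler_norml !ltr_norml => /andP[? ?] /andP[? ?] /andP[? ?].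
by move=> ?; apply/andP; split; lra.
Unshelve. all: by end_near. Qed.

End weak_convergence.

(** * Existence of the weak limit of the cascade *)

Section limit_measure.
Context (b : nat) (hb : (1 < b)%N) (R : realType).
Notation word := (seq (letter hb)).
Notation env := (environment word R).
Variable nu : probability (Sigma hb) R.
Implicit Types (u v : word) (e : env).
Let N := cylinder_mass nu.

Lemma reindex_graft_cat u v e :
  reindex (graft v) (reindex (graft u) e) = reindex (graft (u ++ v)) e.
Proof.
apply/funext => w; rewrite /reindex /graft; case: (w =P [::]) => [//|wn].
case: eqP => [|_]; last by rewrite catA.
by case: v => //=; case: w wn.
Qed.

(** The cylinder of [u] splits into those of its extensions [u ++ v] with [v] of length [j], and the
    weight is constant on each of them. *)
Lemma integral_weight_word_cylinder e u j :
  (\int[nu]_(x in word_cylinder u) (weight e (initial_word x (size u + j)))%:E =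
   (weight e u * partial_mass j (subtree N u) (reindex (graft u) e))%:E)%E.
Proof.
have mw v := @measurable_word_cylinder b hb v.
transitivity (\int[nu]_(x in word_cylinder u) \sum_(v <- words hb j)
    ((weight e (u ++ v))%:E * (\1_(word_cylinder (u ++ v)) x)%:E))%E.
  apply: eq_integral => x; rewrite inE => xu.
  pose v := drop (size u) (initial_word x (size u + j)).
  have xuv : initial_word x (size u + j) = u ++ v.
    rewrite -[LHS](cat_take_drop (size u)) take_initial_word ?leq_addr//.
    by congr (_ ++ _).
  have vj : size v = j.
    by rewrite size_drop size_initial_word addKn.
  rewrite (bigD1_seq v)/=; last 2 first.
  - by rewrite -vj mem_words.
  - exact: words_uniq.
  rewrite indicE mem_set; last first.
    by rewrite /word_cylinder /= -xuv size_initial_word.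
  rewrite mule1 xuv big_seq_cond big1 ?adde0// => v' /andP[/size_words v'j v'v].
  rewrite indicE memNset ?mule0// /word_cylinder /= size_cat v'j xuv => /eqP.
  by rewrite eqseq_cat// eqxx /= eq_sym (negPf v'v).
have mi v : measurable_fun (word_cylinder u)
    (fun x => (\1_(word_cylinder (u ++ v)) x)%:E : \bar R).
  by apply/measurable_EFinP; exact: measurable_indic.
rewrite ge0_integral_sum//; last 2 first.
- by move=> v; apply: emeasurable_funM.
- by move=> v x _; rewrite mule_ge0 ?lee_fin ?weight_ge0.
rewrite /partial_mass big_distrr -sumEFin; apply: eq_bigr => v _ /=.
rewrite ge0_integralZl_EFin ?weight_ge0//.
rewrite integral_indic// setIidl.
  by rewrite mulrA -weight_cat EFinM /subtree /N cylinder_massE.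
by apply: word_cylinder_sub; rewrite take_size_cat.
Qed.

Lemma measurable_weight_initial_word e n :
  measurable_fun setT (fun x : Sigma hb => weight e (initial_word x n)).
Proof.
rewrite (_ : (fun x => _) = fun x =>
    \sum_(v <- words hb n) weight e v * \1_(word_cylinder v) x).
  apply: measurable_sum => v; apply: measurable_funM => //.
  by apply: measurable_indic; exact: measurable_word_cylinder.
apply/funext => x; rewrite (bigD1_seq (initial_word x n))/=; last 2 first.
- by have := mem_words (initial_word x n); rewrite size_initial_word.
- exact: words_uniq.
rewrite indicE mem_set ?mulr1; last exact: initial_word_cylinder.
rewrite big_seq_cond big1 ?addr0// => v /andP[/size_words vn vx].
rewrite indicE memNset ?mulr0// /word_cylinder /= vn => xv.
by move/eqP: vx; rewrite xv.
Qed.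

Lemma weighted_measures_exist e :
  exists m_ : nat -> {finite_measure set (Sigma hb) -> \bar R}, forall n,
    m_ n = (fun A => \int[nu]_(x in A) (weight e (initial_word x n))%:E)%E
      :> (set (Sigma hb) -> \bar R).
Proof.
suff H n : exists m : {finite_measure set (Sigma hb) -> \bar R},
    m = (fun A => \int[nu]_(x in A) (weight e (initial_word x n))%:E)%E
      :> (set (Sigma hb) -> \bar R).
  by exists (fun n => projT1 (cid (H n))) => n; exact: projT2 (cid (H n)).
apply: density_measure_exists.
- by apply/measurable_EFinP; exact: measurable_weight_initial_word.
- by move=> x; rewrite lee_fin weight_ge0.
- by rewrite -(word_cylinder_nil hb) (@integral_weight_word_cylinder e [::] n) ltry.
Qed.

Lemma limit_measure_exists e : convergent_masses N e ->
  exists M : {finite_measure set (Sigma hb) -> \bar R}, weak_cvg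
    (fun n A => \int[nu]_(x in A) (weight e (initial_word x n))%:E)%E M.
Proof.
move=> ce.
pose l u := limn (fun n => partial_mass n (subtree N u) (reindex (graft u) e)).
have N0 := cylinder_mass_ge0 nu.
have l0 u : 0 <= l u.
  by apply: limr_ge; [exact: ce|apply: nearW => n; apply: partial_mass_ge0 => v; exact: N0].
(* The limit masses spread over the children according to their weights; multiplied by the weight of
   [u], they become additive and define the limit measure. *)
have la u : l u = \sum_(i : letter hb) `|e (rcons u i)| * l (rcons u i).
  have cu : convergent_masses (subtree N u) (reindex (graft u) e).
    by move=> v; rewrite subtree_cat reindex_graft_cat; exact: ce.
  rewrite /l (cvg_lim _ (cvg_partial_mass_split (k := 1) cu))//.
  rewrite big_wordsS big_words0; apply: eq_bigr => i _.
  rewrite weight_rcons weight_nil mul1r subtree_cat reindex_graft_cat.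
  by rewrite -[rcons [::] i]/[:: i] {1}/reindex /graft /= !cats1.
have [M ME] : exists M : {finite_measure set (Sigma hb) -> \bar R},
    forall u, M (word_cylinder u) = (weight e u * l u)%:E.
  apply: tree_measure_exists => u; first by rewrite mulr_ge0// weight_ge0.
  by rewrite la big_distrr /=; apply: eq_bigr => i _; rewrite weight_rcons mulrA.
exists M; have [m_ mE] := weighted_measures_exist e.
rewrite (_ : (fun n A => _) = fun n => m_ n : set (Sigma hb) -> \bar R); last first.
  by apply/funext => n; rewrite mE.
apply: weak_cvg_word_cylinders => u.
rewrite ME -(@cvg_shiftn (size u)).
under eq_fun do rewrite mE addnC integral_weight_word_cylinder.
apply/cvg_EFin; first exact: nearW.
by apply: cvgMr; exact: ce.
Qed.

End limit_measure.

(** * From the given weights to their law *)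

Section weights_environment.
Context (R : realType) (b : nat) (hb : (1 < b)%N)
  (d0 : measure_display) (Omega0 : measurableType d0)
  (P0 : probability Omega0 R) (X0 : {RV P0 >-> R})
  (X0_ge0 : forall w, 0 <= X0 w) (X0_mean : ('E_P0[X0] = 1)%E)
  (d : measure_display) (Omega : measurableType d) (P : probability Omega R)
  (X : seq (letter hb) -> {RV P >-> R})
  (X_indep : mutually_independent (nonempty_words hb) X)
  (X_copies : forall u, nonempty_words hb u -> same_distribution (X u) X0).
Notation word := (seq (letter hb)).
Notation env := (environment word R).

(* The weight of the empty word, about which nothing is assumed, is replaced by
   a constant. *)
Definition weights_env (w : Omega) : env := fun u => if u == [::] then 0 else X u w.

Lemma measurable_weights_env : measurable_fun setT weights_env.
Proof.
apply: measurable_to_environment => u; rewrite /weights_env.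
by case: eqP => // _; exact: measurable_funPT.
Qed.

HB.instance Definition _ :=
  isMeasurableFun.Build _ _ Omega env weights_env measurable_weights_env.

Definition weights_law : probability env R := distribution P weights_env.

Lemma weights_law_coordinate u (B : set R) : nonroot u ->
  weights_law [set e | B (e u)] = P (X u @^-1` B).
Proof.
move=> un; rewrite -[LHS]/(P [set w | B (weights_env w u)]).
by rewrite /weights_env (negPf un).
Qed.

Lemma weights_law_independent : independent_coordinates weights_law.
Proof.
move=> s B us mB; rewrite -[LHS]/(P (weights_env @^-1` cylinder s B)).
pose s' := [seq u <- s | u != [::]].
have cyl : (forall u, u \in s -> u = [::] -> B u 0) ->
    weights_env @^-1` cylinder s B = \big[setI/setT]_(u <- s') (X u @^-1` B u).
  move=> B0; rewrite -bigcap_seq cylinderE /weights_env.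
  apply/seteqP; split=> [w /= H u|w /= H u us'].
    by rewrite /= mem_filter => /andP[/negPf un /H]; rewrite un.
  case: eqP => [u0|/eqP u0]; first exact: B0.
  by apply: H; rewrite /= mem_filter u0.
have prod' : (\prod_(u <- s') P (X u @^-1` B u) =
    \prod_(u <- s | u != [::]) weights_law [set e | B u (e u)])%E.
  by rewrite big_filter; apply: eq_bigr => u un; rewrite weights_law_coordinate.
have root u : u = [::] -> weights_law [set e | B u (e u)] = P [set w | B u 0].
  by move=> ->; rewrite -[LHS]/(P [set w | B _ (weights_env w _)]) /weights_env.
(* The root coordinate is the constant 0: either its constraint holds and contributes a factor 1, or
   it fails and both sides vanish. *)
have [B0|nB0] := pselect (forall u, u \in s -> u = [::] -> B u 0).
  rewrite cyl// X_indep ?filter_uniq//; last first.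
    by move=> u; rewrite /= mem_filter => /andP[].
  rewrite [RHS](bigID (fun u => u != [::]))/= [X in (_ * X)%E]big_seq_cond.
  rewrite [X in (_ * X)%E]big1 ?mule1// => u /andP[us']; rewrite negbK => /eqP u0.
  rewrite root// (_ : [set w | _] = setT) ?probability_setT//.
  by apply/seteqP; split => // w _; exact: B0.
have [u us' [u0 nBu]] : exists2 u, u \in s & u = [::] /\ ~ B u 0.
  apply: contrapT => H; apply: nB0 => u us' u0; apply: contrapT => nBu.
  by apply: H; exists u.
rewrite (bigD1_seq u)//= root// (_ : [set w | _] = set0); last first.
  by apply/seteqP; split.
rewrite measure0 mul0e (_ : _ @^-1` _ = set0) ?measure0//.
apply/seteqP; split=> // w; rewrite cylinderE /= => /(_ u us').
by rewrite /weights_env u0 eqxx -u0.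
Qed.

Lemma weights_law_copies u v (B : set R) : nonroot u -> nonroot v ->
  measurable B -> weights_law [set e | B (e u)] = weights_law [set e | B (e v)].
Proof.
move=> un vn mB; rewrite !weights_law_coordinate//.
transitivity (distribution P0 X0 B); first exact: (X_copies un mB).
exact/esym/(X_copies vn mB).
Qed.

Lemma weights_law_mean u : nonroot u -> (\int[weights_law]_e `|e u|%:E = 1)%E.
Proof.
move=> un.
have mabs : measurable_fun setT (fun x : R => `|x|%:E).
  by apply/measurable_EFinP; exact: normr_measurable.
rewrite (@ge0_integral_pushforward _ _ _ _ _ _ measurable_weights_env P setT
  (fun e : env => `|e u|%:E)); last 3 first.
- exact: measurableT.
- by apply: (measurableT_comp mabs); exact: measurable_coordinate.
- by move=> e _; rewrite lee_fin.
transitivity (\int[P]_w `|X u w|%:E)%E.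
  rewrite preimage_setT; apply: eq_integral => w _ /=.
  by rewrite /weights_env (negPf un).
transitivity (\int[distribution P (X u)]_x `|x|%:E)%E.
  by rewrite ge0_integral_distribution// => x; rewrite lee_fin.
(* The absolute value is carried over to [X0], which is nonnegative at every outcome and has mean
   1. *)
transitivity (\int[distribution P0 X0]_x `|x|%:E)%E.
  apply: eq_measure_integral => A mA _; exact: (X_copies un mA).
rewrite ge0_integral_distribution//.
rewrite -X0_mean expectation_def; apply: eq_integral => w _ /=.
by rewrite ger0_norm.
Qed.

Lemma ae_weights_ge0 : {ae P, forall w, forall u, nonroot u -> 0 <= X u w}.
Proof.
apply: ae_forall_countable => u.
have [un|un] := boolP (nonroot u); last by apply: aeW.
have m0 : measurable [set x : R | x < 0].
  rewrite (_ : [set x | _] = `]-oo, 0[%classic); first exact: measurable_itv.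
  by apply/seteqP; split=> x /=; rewrite in_itv.
exists (X u @^-1` [set x : R | x < 0]); split.
- by rewrite -[X in measurable X]setTI; exact: measurable_funPT.
- apply: etrans (X_copies un m0) _; rewrite /distribution /pushforward.
  rewrite (_ : _ @^-1` _ = set0) ?measure0//.
  by apply/seteqP; split => // w /=; rewrite ltNge X0_ge0.
- by move=> w /= /not_implyP[_] /negP; rewrite -ltNge.
Qed.

Lemma ae_weights_law (Q : env -> Prop) : {ae weights_law, forall e, Q e} ->
  {ae P, forall w, Q (weights_env w)}.
Proof.
move=> [N [mN N0 QN]]; exists (weights_env @^-1` N); split => //.
- by rewrite -[X in measurable X]setTI; exact: measurable_weights_env.
- by move=> w nQ; exact: QN.
Qed.

Lemma cascade_weightE w x n : (forall u, nonroot u -> 0 <= X u w) ->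
  cascade_weight X n w x = weight (weights_env w) (initial_word x n).
Proof.
move=> Xw; rewrite /cascade_weight /weight size_initial_word big_add1 big_mkord.
apply: eq_bigr => k _; rewrite take_initial_word// /weights_env.
have kn : initial_word x k.+1 != [::] by rewrite -size_eq0 size_initial_word.
by rewrite (negPf kn) ger0_norm// Xw.
Qed.

Variable nu : probability (Sigma hb) R.
Let N := cylinder_mass nu.

Lemma cascade_measure_mass w : (forall u, nonroot u -> 0 <= X u w) ->
  convergent_masses N (weights_env w) ->
  cascade_measure X nu w setT = limit_mass N (weights_env w).
Proof.
move=> Xw cw; set e := weights_env w.
have wE : weighted_measure X nu w =
    (fun n A => \int[nu]_(x in A) (weight e (initial_word x n))%:E)%E.
  apply/funext => n; apply/funext => A; apply: eq_integral => x _.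
  by rewrite cascade_weightE.
have [M cM] := limit_measure_exists cw.
have limw : has_cascade_limit X nu w by exists M; rewrite wE.
rewrite /cascade_measure; case: pselect => // h.
(* The chosen limit is known only through weak convergence; testing it against the constant 1
   identifies its total mass. *)
set mu := projT1 (cid h); have : weak_cvg (weighted_measure X nu w) mu := projT2 (cid h).
move=> /(_ (cst 1) (@cst_continuous _ _ _)) /(_ _).
have b1 : bounded_fun (cst 1 : Sigma hb -> R).
  by exists 1; split => // r r1 x _; apply: le_trans (ltW r1); rewrite /= normr1.
have int1 (m : {finite_measure set (Sigma hb) -> \bar R}) :
    (\int[m]_x (cst 1 x : R)%:E = m setT)%E.
  by rewrite -[LHS]/(\int[m]_x (cst 1%E x))%E integral_cst// mul1e.
move=> /(_ b1); rewrite int1.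
rewrite (_ : (fun n => _) = fun n => (partial_mass n N e)%:E); last first.
  have [m_ mE] := weighted_measures_exist nu e.
  apply/funext => n; rewrite wE -mE int1 mE.
  rewrite -(word_cylinder_nil hb) (@integral_weight_word_cylinder _ _ _ nu e [::] n).
  by rewrite weight_nil mul1r subtree_nil reindex_graft_nil.
by move=> /cvg_limn_einf_sup[<-].
Qed.

End weights_environment.

Theorem proposition2p7 (R : realType) (b : nat) (hb : (1 < b)%N)
    (d0 : measure_display) (Omega0 : measurableType d0)
    (P0 : probability Omega0 R) (X0 : {RV P0 >-> R})
    (X0_ge0 : forall w, 0 <= X0 w) (X0_mean : ('E_P0[X0] = 1)%E)
    (d : measure_display) (Omega : measurableType d) (P : probability Omega R)
    (X : seq (letter hb) -> {RV P >-> R})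
    (X_indep : mutually_independent (nonempty_words hb) X)
    (X_copies : forall u, nonempty_words hb u -> same_distribution (X u) X0)
    (nu : probability (Sigma hb) R)
    (nu_invariant : shift_invariant nu) (nu_ergodic : shift_ergodic nu) :
  cascade_regular X nu \/ cascade_singular X nu.
Proof.
have indL := weights_law_independent X_indep.
have idL := weights_law_copies X_copies.
have meanL := weights_law_mean X0_ge0 X0_mean X_copies.
have N0 := cylinder_mass_ge0 nu.
have ae_mass : {ae P, forall w,
    cascade_measure X nu w setT = limit_mass (cylinder_mass nu) (weights_env X w)}.
  have ae_cvg := ae_weights_law
    (ae_convergent_masses indL idL meanL N0 (cylinder_mass_additive nu)).
  apply: filterS2 (ae_weights_ge0 X0_ge0 X_copies) ae_cvg => w Xw cw.
  exact: cascade_measure_mass.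
have [I1|Z0] := expected_mass_dichotomy indL idL meanL nu_invariant nu_ergodic.
- left; rewrite /cascade_regular.
  have mZ := measurable_limit_mass (cylinder_mass nu).
  have Z0 e := limit_mass_ge0 e N0.
  rewrite (ge0_ae_eq_integral_nonmeasurable _ _ _ ae_mass)//; last first.
    by apply: (measurableT_comp mZ); exact: measurable_weights_env.
  apply: etrans (esym (probability_setT nu)); rewrite -I1 /expected_mass.
  rewrite (@ge0_integral_pushforward _ _ _ _ _ _ (measurable_weights_env X) P setT
    (limit_mass (cylinder_mass nu)))//.
- right; apply: filterS2 ae_mass (ae_weights_law Z0) => w wE Zw A mA.
  (* A measure of total mass zero vanishes on every Borel set. *)
  apply/eqP; rewrite eq_le measure_ge0 andbT.
  rewrite -Zw -wE; apply: le_measure; rewrite ?inE//.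
Qed.
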